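(* Let $n\ge 1$, let $q=d_1y_1^2+\cdots+d_{n-1}y_{n-1}^2$ be a positive definite, integral, primitive quadratic form with $d_1,\dots,d_{n-1}$ squarefree positive integers, let $K=\mathbb{Q}[\sqrt{d_1}\,i_1,\dots,\sqrt{d_{n-1}}\,i_{n-1}]\subset \mathbb{C}_n$, and let $O\subset K$ be an order closed under the reversal involution $*$. Then the collection $\mathcal{P}$ of Ford spheres of $\operatorname{PSL}_2(O)$ is an integral packing in $\mathcal{H}^{n+1}$: the horoballs bounded by any two distinct Ford spheres have disjoint interiors, and the curvature (reciprocal of the Euclidean radius) of every Ford sphere is an integer.
   Context: Clifford numbers: $\mathbb{C}_m$ is the real algebra generated by $i_1,\dots,i_{m-1}$ with $i_a^2=-1$ and $i_ai_b=-i_bi_a$ for $a\ne b$ ($\mathbb{C}_1=\mathbb{R}$); $\mathbb{C}_n\subset\mathbb{C}_{n+1}$. The Clifford vectors are $V_m=\{x_0+x_1i_1+\cdots+x_{m-1}i_{m-1}: x_j\in\mathbb{R}\}\cong\mathbb{R}^m$, with $|x|^2=\sum x_j^2$. Involutions: $x\mapsto x'$ (automorphism with $i_a\mapsto -i_a$), $x\mapsto x^*$ (anti-automorphism reversing products of generators, fixing each $i_a$), and $\bar x=(x')^*$. The Clifford group $\Gamma_n$ is the multiplicative group generated by nonzero elements of $V_n$; for $x\in\Gamma_n$, $x\bar x=|x|^2>0$. $\operatorname{SL}_2(\mathbb{C}_n)$ is the group of matrices $\begin{pmatrix}a&b\\c&d\end{pmatrix}$ with $a,b,c,d\in\Gamma_n\cup\{0\}$,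 $ad^*-bc^*=1$, and $ab^*,cd^*,c^*a,d^*b\in V_n$; it acts on $V_{n+1}\cup\{\infty\}$ by $x\mapsto(ax+b)(cx+d)^{-1}$ (computed in $\mathbb{C}_{n+1}$), preserving hyperbolic space $\mathcal{H}^{n+1}=\{x\in V_{n+1}: x_n>0\}$ with metric $(dx_0^2+\cdots+dx_n^2)/x_n^2$ and its boundary $V_n\cup\{\infty\}$; $\operatorname{PSL}_2=\operatorname{SL}_2/\{\pm1\}$. An order is a subring of $K$ that is a full $\mathbb{Z}$-lattice in $K$. $\operatorname{SL}_2(O)$ consists of $g\in\operatorname{SL}_2(\mathbb{C}_n)$ with $g$ and $g^{-1}$ having entries in $O$. The sphere at infinity is $S_\infty=\{x\in V_{n+1}: x_n=1\}$, and the Ford spheres are the images $\gamma(S_\infty)$, $\gamma\in\operatorname{PSL}_2(O)$; apart from horizontal hyperplanes (curvature $0$), these are Euclidean spheres in $\mathcal{H}^{n+1}$ tangent to $V_n=\{x_n=0\}$. *)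

(* Defs.v *)
From HB Require Import structures.
From mathcomp Require Import all_boot all_order all_algebra.
From mathcomp Require Import all_classical all_reals all_analysis.
From mathcomp Require Import ring.

Set Implicit Arguments.
Unset Strict Implicit.
Unset Printing Implicit Defensive.

Import Order.TTheory GRing.Theory Num.Theory.
Import numFieldNormedType.Exports.

Local Open Scope ring_scope.

Definition symdiff (T : finType) (A B : {set T}) : {set T} :=
  [set a | (a \in A) (+) (a \in B)]%SET.

Lemma in_symdiff (T : finType) (A B : {set T}) a :
  (a \in symdiff A B) = (a \in A) (+) (a \in B).
Proof. by rewrite inE. Qed.

Lemma symdiffA (T : finType) : associative (@symdiff T).
Proof. by move=> A B C; apply/setP=> a; rewrite !in_symdiff addbA. Qed.

Lemma symdiffC (T : finType) : commutative (@symdiff T).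
Proof. by move=> A B; apply/setP=> a; rewrite !in_symdiff addbC. Qed.

Lemma symdiff0 (T : finType) : right_id finset.set0 (@symdiff T).
Proof. by move=> A; apply/setP=> a; rewrite in_symdiff inE addbF. Qed.

Lemma sym0diff (T : finType) : left_id finset.set0 (@symdiff T).
Proof. by move=> A; rewrite symdiffC symdiff0. Qed.

Lemma symdiffK (T : finType) (A : {set T}) :
  involutive (symdiff A).
Proof.
by move=> B; apply/setP=> a; rewrite !in_symdiff addbA addbb addFb.
Qed.

(* The Clifford algebra C_m: x : Cl R m stands for the sum over S of x S * e_S,
   where e_S is the increasing product of the generators indexed by S.  The
   index a : 'I_m.-1 is that of the generator i_(a+1). *)
Definition Cl (R : realType) (m : nat) : Type := {ffun {set 'I_m.-1} -> R}.

HB.instance Definition _ (R : realType) (m : nat) :=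
  GRing.Lmodule.copy (Cl R m) {ffun {set 'I_m.-1} -> R^o}.

Definition ClE (R : realType) (m : nat) (S : {set 'I_m.-1}) : Cl R m :=
  [ffun T => (T == S)%:R].

(* e_S e_T = clsign S T * e_(S symdiff T): bringing e_S e_T into increasing
   order costs one sign for each a in S, b in T with b < a (anticommutation),
   and one for each a = b (i_a ^ 2 = -1). *)
Definition clsign (R : realType) (k : nat) (S T : {set 'I_k}) : R :=
  \prod_(a in S) \prod_(b in T) (-1) ^+ (b <= a)%N.

Definition clmul (R : realType) (m : nat) (x y : Cl R m) : Cl R m :=
  [ffun U => \sum_S clsign R S (symdiff S U) * (x S * y (symdiff S U))].

Lemma prod_symdiff (R : realType) (T : finType) (f : T -> R) (A B : {set T}) :
    (forall a, f a * f a = 1) ->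
  \prod_(a in symdiff A B) f a = (\prod_(a in A) f a) * \prod_(a in B) f a.
Proof.
move=> ff; rewrite big_mkcond [X in X * _]big_mkcond [X in _ * X]big_mkcond.
rewrite -big_split /=; apply: eq_bigr => a _; rewrite in_symdiff.
by case: (a \in A); case: (a \in B); rewrite /= ?ff ?mulr1 ?mul1r.
Qed.

Lemma sqr_prod_eq1 (R : realType) (T : finType) (P : pred T) (f : T -> R) :
  (forall a, f a * f a = 1) -> (\prod_(a | P a) f a) * \prod_(a | P a) f a = 1.
Proof. by move=> ff; rewrite -big_split big1 //= => a _; exact: ff. Qed.

Lemma sgn_sqr (R : realType) (b : bool) : (-1) ^+ b * (-1) ^+ b = 1 :> R.
Proof. by case: b; rewrite ?mulrNN ?mulr1. Qed.

Lemma clsignDl (R : realType) (k : nat) (S T U : {set 'I_k}) :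
  clsign R (symdiff S T) U = clsign R S U * clsign R T U.
Proof.
apply: prod_symdiff => a; apply: sqr_prod_eq1 => b; exact: sgn_sqr.
Qed.

Lemma clsignDr (R : realType) (k : nat) (S T U : {set 'I_k}) :
  clsign R S (symdiff T U) = clsign R S T * clsign R S U.
Proof.
rewrite /clsign -big_split; apply: eq_bigr => a _.
by apply: prod_symdiff => b; exact: sgn_sqr.
Qed.

Lemma clsign_sqr (R : realType) (k : nat) (S T : {set 'I_k}) :
  clsign R S T * clsign R S T = 1.
Proof.
apply: sqr_prod_eq1 => a; apply: sqr_prod_eq1 => b; exact: sgn_sqr.
Qed.

Lemma clsign0s (R : realType) (k : nat) (S : {set 'I_k}) : clsign R finset.set0 S = 1.
Proof. by rewrite /clsign big_set0. Qed.

Lemma clsigns0 (R : realType) (k : nat) (S : {set 'I_k}) : clsign R S finset.set0 = 1.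
Proof. by rewrite /clsign big1 // => a _; rewrite big_set0. Qed.

Lemma clmulA (R : realType) (m : nat) : associative (@clmul R m).
Proof.
move=> x y z; apply/ffunP=> U; rewrite !ffunE.
under eq_bigr => S _ do rewrite ffunE mulr_sumr mulr_sumr.
under [RHS]eq_bigr => S _ do rewrite ffunE mulr_suml mulr_sumr.
rewrite [RHS]exchange_big; apply: eq_bigr => S _ /=.
rewrite [RHS](reindex_inj (inv_inj (symdiffK S))); apply: eq_bigr => T _ /=.
rewrite (symdiffK S) -(symdiffA S T U) [in RHS]clsignDl.
have -> : symdiff T (symdiff S U) = symdiff S (symdiff T U).
  by rewrite symdiffA (symdiffC T) -symdiffA.
set V := symdiff S (symdiff T U).
have -> : symdiff S U = symdiff T V.
  by rewrite /V [symdiff T _]symdiffA (symdiffC T) -symdiffA symdiffK.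
rewrite clsignDr.
ring.
Qed.

Lemma clmul1x (R : realType) (m : nat) : left_id (ClE R finset.set0) (@clmul R m).
Proof.
move=> x; apply/ffunP=> U; rewrite ffunE (bigD1 finset.set0) //= big1 => [|S nS].
  by rewrite ffunE eqxx clsign0s sym0diff !mul1r addr0.
by rewrite ffunE (negbTE nS) mul0r mulr0.
Qed.

Lemma clmulx1 (R : realType) (m : nat) : right_id (ClE R finset.set0) (@clmul R m).
Proof.
move=> x; apply/ffunP=> U; rewrite ffunE (bigD1 U) //= big1 => [|S nS].
  have -> : symdiff U U = finset.set0 by apply/setP=> a; rewrite in_symdiff inE addbb.
  by rewrite ffunE eqxx clsigns0 mul1r mulr1 addr0.
rewrite ffunE; case: eqP => [e|]; last by rewrite !mulr0.
by move: nS; rewrite -(symdiffK S U) e symdiff0 eqxx.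
Qed.

Lemma clmulDl (R : realType) (m : nat) : left_distributive (@clmul R m) +%R.
Proof.
move=> x y z; apply/ffunP=> U; rewrite !ffunE -big_split; apply: eq_bigr => S _.
by rewrite ffunE mulrDl mulrDr.
Qed.

Lemma clmulDr (R : realType) (m : nat) : right_distributive (@clmul R m) +%R.
Proof.
move=> x y z; apply/ffunP=> U; rewrite !ffunE -big_split; apply: eq_bigr => S _.
by rewrite ffunE mulrDr mulrDr.
Qed.

Lemma cl1_neq0 (R : realType) (m : nat) : ClE R finset.set0 != 0 :> Cl R m.
Proof.
apply/eqP => /ffunP /(_ finset.set0); rewrite !ffunE eqxx => /eqP.
by rewrite oner_eq0.
Qed.

HB.instance Definition _ (R : realType) (m : nat) :=
  GRing.Zmodule_isNzRing.Build (Cl R m)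
    (@clmulA R m) (@clmul1x R m) (@clmulx1 R m)
    (@clmulDl R m) (@clmulDr R m) (@cl1_neq0 R m).

Lemma clscalerAl (R : realType) (m : nat) (c : R) (x y : Cl R m) :
  c *: (x * y) = (c *: x) * y.
Proof.
apply/ffunP=> U; rewrite !ffunE scaler_sumr; apply: eq_bigr => S _.
by rewrite ffunE /GRing.scale /=; ring.
Qed.

HB.instance Definition _ (R : realType) (m : nat) :=
  GRing.Lmodule_isLalgebra.Build R (Cl R m) (@clscalerAl R m).

Lemma clscalerAr (R : realType) (m : nat) (c : R) (x y : Cl R m) :
  c *: (x * y) = x * (c *: y).
Proof.
apply/ffunP=> U; rewrite !ffunE scaler_sumr; apply: eq_bigr => S _.
by rewrite ffunE /GRing.scale /=; ring.
Qed.

HB.instance Definition _ (R : realType) (m : nat) :=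
  GRing.Lalgebra_isAlgebra.Build R (Cl R m) (@clscalerAr R m).

Definition clunit (R : realType) (m : nat) : pred (Cl R m) :=
  fun x => `[< exists y : Cl R m, y * x = 1 /\ x * y = 1 >].

Definition clinv (R : realType) (m : nat) (x : Cl R m) : Cl R m :=
  xget x [set y : Cl R m | y * x = 1 /\ x * y = 1]%classic.

Lemma clinvP (R : realType) (m : nat) (x : Cl R m) :
  clunit x -> clinv x * x = 1 /\ x * clinv x = 1.
Proof. by move=> /asboolP ux; exact: (xgetPex x ux). Qed.

Lemma clmulVx (R : realType) (m : nat) :
  {in @clunit R m, left_inverse 1 (@clinv R m) *%R}.
Proof. by move=> x /clinvP[]. Qed.

Lemma clmulxV (R : realType) (m : nat) :
  {in @clunit R m, right_inverse 1 (@clinv R m) *%R}.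
Proof. by move=> x /clinvP[]. Qed.

Lemma clunitP (R : realType) (m : nat) (x y : Cl R m) :
  y * x = 1 /\ x * y = 1 -> clunit x.
Proof. by move=> xy; apply/asboolP; exists y. Qed.

Lemma clinv_out (R : realType) (m : nat) :
  {in [predC @clunit R m], @clinv R m =1 id}.
Proof.
move=> x; rewrite inE /clinv => /asboolPn nux.
by case: xgetP => // y _ xy; case: nux; exists y.
Qed.

HB.instance Definition _ (R : realType) (m : nat) :=
  GRing.NzRing_hasMulInverse.Build (Cl R m)
    (@clmulVx R m) (@clmulxV R m) (@clunitP R m) (@clinv_out R m).

Definition clgen (R : realType) (m : nat) (a : 'I_m.-1) : Cl R m :=
  ClE R [set a]%SET.

Lemma ClE0 (R : realType) (m : nat) : ClE R finset.set0 = 1 :> Cl R m.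
Proof. by []. Qed.

Lemma ClEM (R : realType) (m : nat) (S T : {set 'I_m.-1}) :
  ClE R S * ClE R T = clsign R S T *: ClE R (symdiff S T) :> Cl R m.
Proof.
apply/ffunP=> U; rewrite !ffunE (bigD1 S) //= big1 => [|V nV]; last first.
  by rewrite !ffunE (negbTE nV) mul0r mulr0.
rewrite !ffunE eqxx mul1r addr0.
have -> : (symdiff S U == T) = (U == symdiff S T).
  by apply/eqP/eqP => [<-|->]; rewrite symdiffK.
by case: eqP => [->|]; rewrite ?symdiffK ?mulr0 ?scaler0.
Qed.

Lemma clgen_sqr (R : realType) (m : nat) (a : 'I_m.-1) :
  clgen R a * clgen R a = -1.
Proof.
rewrite /clgen ClEM /clsign !big_set1 leqnn expr1.
have -> : symdiff [set a]%SET [set a]%SET = finset.set0.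
  by apply/setP=> b; rewrite in_symdiff addbb inE.
by rewrite ClE0 scaleN1r.
Qed.

Lemma clgen_anticomm (R : realType) (m : nat) (a b : 'I_m.-1) :
  a != b -> clgen R a * clgen R b = - (clgen R b * clgen R a).
Proof.
move=> nab; rewrite /clgen !ClEM symdiffC -scaleNr; congr (_ *: _).
rewrite /clsign !big_set1.
case: (ltngtP a b) nab => [lt|lt|/val_inj->]; rewrite ?eqxx // => _;
  by rewrite expr0 expr1 ?opprK.
Qed.

(* Reversing the increasing product e_S of k generators takes 'C(k, 2)
   transpositions. *)
Definition clrev (R : realType) (m : nat) (x : Cl R m) : Cl R m :=
  [ffun S : {set 'I_m.-1} => (-1) ^+ 'C(#|S|, 2) * x S].

Lemma clrev_gen (R : realType) (m : nat) (a : 'I_m.-1) :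
  clrev (clgen R a) = clgen R a.
Proof.
apply/ffunP=> S; rewrite !ffunE; case: eqP => [->|]; last by rewrite mulr0.
by rewrite cards1 mul1r.
Qed.

Lemma clrev_linear (R : realType) (m : nat) (c : R) (x y : Cl R m) :
  clrev (c *: x + y) = c *: clrev x + clrev y.
Proof. by apply/ffunP=> S; rewrite !ffunE /GRing.scale /=; ring. Qed.

Lemma card_pairs (k : nat) (S : {set 'I_k}) :
  (\sum_(a in S) \sum_(b in S) (b < a) = 'C(#|S|, 2))%N.
Proof.
set N := (\sum_(a in S) _)%N.
suff e : (N.*2 + #|S| = #|S| * #|S|)%N.
  rewrite bin2; have -> : (#|S| * #|S|.-1 = N.*2)%N; last by rewrite doubleK.
  by case: #|S| e => [|s] /= /eqP; rewrite ?mulnS ?(addnC s.+1) ?eqn_add2r;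
    [rewrite addn0 muln0 => /eqP -> | move=> /eqP ->; rewrite mulnC].
rewrite -addnn {2}/N exchange_big /= /N -big_split /=.
rewrite -sum1_card -big_split /= big_distrl /=; apply: eq_bigr => a aS.
rewrite mul1n -big_split /= (bigD1 a) //= [in RHS](bigD1 a) //= ltnn addnC.
congr (_ + _)%N; apply: eq_bigr => b /andP[_].
by rewrite -val_eqE /=; case: ltngtP.
Qed.

Lemma clrev_sign (R : realType) (k : nat) (S : {set 'I_k}) :
  (-1) ^+ 'C(#|S|, 2) = clsign R S S * (-1) ^+ #|S| :> R.
Proof.
rewrite -card_pairs -prodrXr -prodr_const -big_split /=.
apply: eq_bigr => a aS; rewrite -prodrXr (bigD1 a) //= [in RHS](bigD1 a) //=.
rewrite ltnn leqnn expr0 mul1r expr1 mulrAC mulrNN mulr1 mul1r.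
by apply: eq_bigr => b /andP[_]; rewrite -val_eqE /= ltn_neqAle => ->.
Qed.

Lemma clrevM (R : realType) (m : nat) (x y : Cl R m) :
  clrev (x * y) = clrev y * clrev x.
Proof.
apply/ffunP=> U; rewrite !ffunE mulr_sumr.
have invU : involutive (fun S => symdiff S U).
  by move=> S; rewrite [symdiff S U]symdiffC symdiffC symdiffK.
rewrite [RHS](reindex_inj (inv_inj invU)); apply: eq_bigr => S _ /=.
rewrite invU !ffunE; set T := symdiff S U.
have -> : U = symdiff S T by rewrite symdiffK.
move: T => T.
have e1 : (-1) ^+ #|symdiff S T| = (-1) ^+ #|S| * (-1) ^+ #|T| :> R.
  by rewrite -!prodr_const prod_symdiff // => a; rewrite mulrNN mulr1.
rewrite !clrev_sign e1 clsignDl !clsignDr.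
have := clsign_sqr R S T; set s := clsign R S T => ss.
transitivity ((s * s) * (clsign R S S * clsign R T S * clsign R T T *
  (-1) ^+ #|S| * (-1) ^+ #|T| * x S * y T)); first ring.
by rewrite ss; ring.
Qed.

(* The inclusion C_n -> C_(n+1) *)
Definition clemb (R : realType) (n : nat) (x : Cl R n) : Cl R n.+1 :=
  \sum_S x S *: ClE R (widen_ord (leq_pred n) @: S : {set 'I_n.+1.-1})%SET.

(* The vector x_0 + x_1 i_1 + ... + x_(m-1) i_(m-1) of V_m, from its coordinates:
   the set indexing the basis element is empty for j = 0, and {j - 1} otherwise. *)
Definition clvec (R : realType) (m : nat) (x : 'rV[R]_m) : Cl R m :=
  \sum_(j < m) x 0 j *: ClE R [set a : 'I_m.-1 | a.+1 == j :> nat]%SET.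

Local Open Scope classical_set_scope.

Definition clV (R : realType) (m : nat) : set (Cl R m) := range (@clvec R m).

Inductive cliffGroup (R : realType) (m : nat) : Cl R m -> Prop :=
| cliffGroup_vec v : clV v -> v <> 0 -> cliffGroup v
| cliffGroup_one : cliffGroup 1
| cliffGroup_mul x y : cliffGroup x -> cliffGroup y -> cliffGroup (x * y)
| cliffGroup_inv x : cliffGroup x -> cliffGroup x^-1.

Definition SL2 (R : realType) (n : nat) : set 'M[Cl R n]_2 :=
  [set g | let: (a, b, c, d) := (g 0 0, g 0 1, g 1 0, g 1 1) in
    [/\ forall i j, cliffGroup (g i j) \/ g i j = 0,
        a * clrev d - b * clrev c = 1,
        clV (a * clrev b) /\ clV (c * clrev d) &
        clV (clrev c * a) /\ clV (clrev d * b)]].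

Definition SL2_over (R : realType) (n : nat) (O : set (Cl R n)) :
    set 'M[Cl R n]_2 :=
  [set g | [/\ SL2 g, forall i j, O (g i j) &
     exists h : 'M[Cl R n]_2,
       [/\ g *m h = 1%:M, h *m g = 1%:M & forall i j, O (h i j)]]].

Definition PSL2_over (R : realType) (n : nat) (O : set (Cl R n)) :
    set (set 'M[Cl R n]_2) :=
  [set [set g; - g] | g in SL2_over O].

(* y = g x, for x and y in V_(n+1); there is no such y when g x is infinite. *)
Definition moebius (R : realType) (n : nat) (g : 'M[Cl R n]_2)
    (x y : 'rV[R]_n.+1) : Prop :=
  let den := clemb (g 1 0) * clvec x + clemb (g 1 1) in
  den \is a GRing.unit /\
  clvec y = (clemb (g 0 0) * clvec x + clemb (g 0 1)) / den.

Definition PSL2_image (R : realType) (n : nat) (gamma : set 'M[Cl R n]_2)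
    (A : set 'rV[R]_n.+1) : set 'rV[R]_n.+1 :=
  [set y | exists2 g, gamma g & exists2 x, A x & moebius g x y].

(* K = Q[sqrt d_1 i_1, ..., sqrt d_(n-1) i_(n-1)] *)
Inductive Kalg (R : realType) (n : nat) (d : 'I_n.-1 -> nat) : Cl R n -> Prop :=
| Kalg_rat (r : rat) : Kalg d (ratr r)%:A
| Kalg_gen a : Kalg d (Num.sqrt (d a)%:R *: clgen R a)
| Kalg_add x y : Kalg d x -> Kalg d y -> Kalg d (x + y)
| Kalg_mul x y : Kalg d x -> Kalg d y -> Kalg d (x * y).

Definition full_lattice (R : realType) (n : nat) (K L : set (Cl R n)) : Prop :=
  exists (r : nat) (b : 'I_r -> Cl R n),
    [/\ forall c : 'I_r -> rat,
          \sum_i ratr (c i) *: b i = 0 -> forall i, c i = 0,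
        K = [set \sum_i ratr (c i) *: b i | c in [set: 'I_r -> rat]] &
        L = [set \sum_i b i *~ z i | z in [set: 'I_r -> int]]].

Definition is_order (R : realType) (n : nat) (K O : set (Cl R n)) : Prop :=
  [/\ O `<=` K, O 1,
      forall x y, O x -> O y -> O (x - y),
      forall x y, O x -> O y -> O (x * y) &
      full_lattice K O].

Definition squarefree (m : nat) : Prop :=
  forall k : nat, (k ^ 2 %| m)%N -> k = 1%N.

Definition diag_form (R : realType) (k : nat) (d : 'I_k -> nat)
    (y : 'rV[R]_k) : R :=
  \sum_(a < k) (d a)%:R * y 0 a ^+ 2.

(* The empty form (n = 1) counts as primitive. *)
Definition primitive_diag (k : nat) (d : 'I_k -> nat) : Prop :=
  (0 < k)%N -> \big[gcdn/0%N]_(a < k) d a = 1%N.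

Definition enorm (R : realType) (m : nat) (x : 'rV[R]_m) : R :=
  Num.sqrt (\sum_(j < m) x 0 j ^+ 2).

Definition Hyp (R : realType) (n : nat) : set 'rV[R]_n.+1 :=
  [set x | 0 < x 0 ord_max].

Definition sphere_infty (R : realType) (n : nat) : set 'rV[R]_n.+1 :=
  [set x | x 0 ord_max = 1].

Definition ford_spheres (R : realType) (n : nat) (O : set (Cl R n)) :
    set (set 'rV[R]_n.+1) :=
  [set PSL2_image gamma (@sphere_infty R n) | gamma in PSL2_over O].

(* In the next two definitions, a horosphere of the half-space model is either
   a Euclidean sphere tangent to x_n = 0 (without its point of tangency), whose
   centre thus has height equal to its radius, or a horizontal hyperplane. *)
Variant curvature (R : realType) (n : nat) (S : set 'rV[R]_n.+1) : R -> Prop :=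
| curvature_sphere (c : 'rV[R]_n.+1) (r : R) of
    0 < r & c 0 ord_max = r & S = [set x | Hyp x /\ enorm (x - c) = r] :
    curvature S r^-1
| curvature_hyperplane (h : R) of 0 < h & S = [set x | x 0 ord_max = h] :
    curvature S 0.

Variant horoball (R : realType) (n : nat) (S : set 'rV[R]_n.+1) :
    set 'rV[R]_n.+1 -> Prop :=
| horoball_sphere (c : 'rV[R]_n.+1) (r : R) of
    0 < r & c 0 ord_max = r & S = [set x | Hyp x /\ enorm (x - c) = r] :
    horoball S [set x | Hyp x /\ enorm (x - c) <= r]
| horoball_hyperplane (h : R) of 0 < h & S = [set x | x 0 ord_max = h] :
    horoball S [set x | h <= x 0 ord_max].

Definition integral_packing (R : realType) (n : nat)
    (P : set (set 'rV[R]_n.+1)) : Prop :=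
  [/\ forall S, P S -> exists B, horoball S B,
      forall S1 S2 B1 B2, P S1 -> P S2 -> S1 <> S2 ->
        horoball S1 B1 -> horoball S2 B2 -> interior B1 `&` interior B2 = set0,
      forall S, P S -> exists k, curvature S k &
      forall S k, P S -> curvature S k -> exists z : int, k = z%:~R].

(* Main.v *)
Require Import Defs.
From HB Require Import structures.
From mathcomp Require Import all_boot all_order all_algebra.
From mathcomp Require Import all_classical all_reals all_analysis.
From mathcomp Require Import ring lra.

Set Implicit Arguments.
Unset Strict Implicit.
Unset Printing Implicit Defensive.

Import Order.TTheory GRing.Theory Num.Theory.
Import numFieldNormedType.Exports.

Local Open Scope classical_set_scope.
Local Open Scope ring_scope.

(* For g = (a b; c d) in SL_2(O) with c <> 0, writing p = a c^-1 and w = c^-1 d in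
   V_n, one has (g x - p) (c (x + w) c^* ) = -1, and x |-> c x c^* scales the last
   coordinate by |c|^2.  So g (S_oo) is the sphere of radius 1 / (2 |c|^2) tangent
   to V_n at p; if c = 0, it is the hyperplane of height |a|^2.

   If x in O lies in the Clifford group then |x|^2 is an integer: the powers
   |x|^(2k) = |x^k|^2 are rational with bounded denominators, since O has a
   finite basis over Z.  Hence the curvature 2 |c|^2 is an integer, and
   horizontal Ford spheres have height 1.

   For two Ford spheres the element a_1^* c_2 - c_1^* a_2 = c_1^* (p_1 - p_2) c_2
   is in O, so either it is nonzero, has norm at least 1, and the balls have
   disjoint interiors, or p_1 = p_2.  In the latter case c_1 and c_2 divide each
   other in O, so that |c_1| = |c_2| and the spheres coincide. *)

(** * Involutions and the norm of the Clifford algebra *)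

Lemma ClE_sum (R : realType) (m : nat) (x : Cl R m) :
  x = \sum_S x S *: ClE R S.
Proof.
apply/ffunP=> U; rewrite sum_ffunE (bigD1 U) //= big1 => [|S nS].
  by rewrite !ffunE eqxx addr0 /GRing.scale /= mulr1.
by rewrite !ffunE eq_sym (negbTE nS) /GRing.scale /= mulr0.
Qed.

HB.instance Definition _ (R : realType) (m : nat) :=
  GRing.isLinear.Build R (Cl R m) (Cl R m) _ (@clrev R m)
    (@clrev_linear R m).

(* bar(e_S) = e_S^-1, and e_S e_S = clsign S S. *)
Definition clbar (R : realType) (m : nat) (x : Cl R m) : Cl R m :=
  [ffun S : {set 'I_m.-1} => clsign R S S * x S].

Lemma clbar_linear (R : realType) (m : nat) : linear (@clbar R m).
Proof.
by move=> c x y; apply/ffunP=> S; rewrite !ffunE /GRing.scale /=; ring.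
Qed.

HB.instance Definition _ (R : realType) (m : nat) :=
  GRing.isLinear.Build R (Cl R m) (Cl R m) _ (@clbar R m)
    (@clbar_linear R m).

Lemma clbarM (R : realType) (m : nat) (x y : Cl R m) :
  clbar (x * y) = clbar y * clbar x.
Proof.
apply/ffunP=> U; rewrite !ffunE mulr_sumr.
have invU : involutive (fun S => symdiff S U).
  by move=> S; rewrite [symdiff S U]symdiffC symdiffC symdiffK.
rewrite [RHS](reindex_inj (inv_inj invU)); apply: eq_bigr => S _ /=.
rewrite invU !ffunE; set T := symdiff S U.
have -> : U = symdiff S T by rewrite symdiffK.
move: T => T; rewrite clsignDl !clsignDr.
have := clsign_sqr R S T; set s := clsign R S T => ss.
transitivity ((s * s) * (clsign R S S * clsign R T S * clsign R T T
  * x S * y T)); first ring.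
by rewrite ss; ring.
Qed.

Lemma clrevK (R : realType) (m : nat) : involutive (@clrev R m).
Proof.
by move=> x; apply/ffunP=> S; rewrite !ffunE mulrA -expr2 sqrr_sign mul1r.
Qed.

Lemma clbarK (R : realType) (m : nat) : involutive (@clbar R m).
Proof. by move=> x; apply/ffunP=> S; rewrite !ffunE mulrA clsign_sqr mul1r. Qed.

Lemma clrev1 (R : realType) (m : nat) : clrev (1 : Cl R m) = 1.
Proof.
by have := clrevM 1 (clrev 1 : Cl R m); rewrite mul1r clrevK mul1r => <-.
Qed.

Lemma clbar1 (R : realType) (m : nat) : clbar (1 : Cl R m) = 1.
Proof. by have := clbarM 1 (clbar 1 : Cl R m); rewrite mul1r clbarK mul1r => <-. Qed.

Lemma clbar_gen (R : realType) (m : nat) (a : 'I_m.-1) :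
  clbar (clgen R a) = - clgen R a.
Proof.
apply/ffunP=> S; rewrite !ffunE; case: eqP => [->|]; last by rewrite mulr0 oppr0.
by rewrite /clsign !big_set1 leqnn expr1 mulr1.
Qed.

Lemma clrev_inv (R : realType) (m : nat) (x : Cl R m) :
  x \is a GRing.unit -> clrev x^-1 = (clrev x)^-1.
Proof.
move=> ux; have e1 : clrev x * clrev x^-1 = 1 by rewrite -clrevM mulVr ?clrev1.
have e2 : clrev x^-1 * clrev x = 1 by rewrite -clrevM mulrV ?clrev1.
have u : clrev x \is a GRing.unit by apply/unitrP; exists (clrev x^-1).
by apply: (mulrI u); rewrite e1 mulrV.
Qed.

Lemma clrev_unit (R : realType) (m : nat) (x : Cl R m) :
  x \is a GRing.unit -> clrev x \is a GRing.unit.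
Proof.
move=> ux; apply/unitrP; exists (clrev x^-1).
by rewrite -!clrevM mulVr ?mulrV ?clrev1.
Qed.

(** On the Clifford group this is |x|^2 = x bar(x), see [cliffGroup_mul_bar]. As a sum of squares it
    is defined and positive definite on the whole algebra. *)
Definition clnorm2 (R : realType) (m : nat) (x : Cl R m) : R :=
  \sum_S x S ^+ 2.

(** Only the products of e_S with itself reach the scalar coefficient, and the sign in [clbar]
    cancels that of e_S e_S. *)
Lemma clmul_bar0 (R : realType) (m : nat) (x : Cl R m) :
  (x * clbar x : Cl R m) finset.set0 = clnorm2 x.
Proof.
rewrite ffunE; apply: eq_bigr => S _; rewrite symdiff0 ffunE.
by rewrite -[RHS]mul1r -(clsign_sqr R S S); ring.
Qed.

Lemma clnorm2_bar (R : realType) (m : nat) (x : Cl R m) :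
  clnorm2 (clbar x) = clnorm2 x.
Proof.
by apply: eq_bigr => S _; rewrite ffunE exprMn expr2 clsign_sqr mul1r.
Qed.

Lemma clmul_0bar (R : realType) (m : nat) (x : Cl R m) :
  (clbar x * x : Cl R m) finset.set0 = clnorm2 x.
Proof. by rewrite -{2}[x]clbarK clmul_bar0 clnorm2_bar. Qed.

Lemma clnorm2_rev (R : realType) (m : nat) (x : Cl R m) :
  clnorm2 (clrev x) = clnorm2 x.
Proof. by apply: eq_bigr => S _; rewrite ffunE exprMn sqrr_sign mul1r. Qed.

Lemma clnorm2_ge0 (R : realType) (m : nat) (x : Cl R m) : 0 <= clnorm2 x.
Proof. by apply: sumr_ge0 => S _; rewrite sqr_ge0. Qed.

Lemma clnorm2_eq0 (R : realType) (m : nat) (x : Cl R m) :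
  (clnorm2 x == 0) = (x == 0).
Proof.
apply/idP/eqP => [|->]; last by rewrite /clnorm2 big1 // => S _; rewrite ffunE expr0n.
rewrite psumr_eq0 => [/allP h|S _]; last exact: sqr_ge0.
apply/ffunP=> S; rewrite ffunE; apply/eqP.
by rewrite -sqrf_eq0; apply: h; rewrite mem_index_enum.
Qed.

Lemma clnorm2_1 (R : realType) (m : nat) : clnorm2 (1 : Cl R m) = 1.
Proof. by rewrite -clmul_bar0 clbar1 mulr1 ffunE eqxx. Qed.

(** * Clifford vectors and their Euclidean inner product *)

Definition rvdot (R : realType) (m : nat) (x y : 'rV[R]_m) : R :=
  \sum_j x 0 j * y 0 j.

Definition rvbar (R : realType) (m : nat) (x : 'rV[R]_m) : 'rV[R]_m :=
  \row_j (if j == 0 :> nat then x 0 j else - x 0 j).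

Lemma rvbarK (R : realType) (m : nat) : involutive (@rvbar R m).
Proof.
by move=> x; apply/rowP=> j; rewrite !mxE; case: eqP; rewrite ?opprK.
Qed.

Lemma rvdot_bar (R : realType) (m : nat) (x : 'rV[R]_m) :
  rvdot (rvbar x) (rvbar x) = rvdot x x.
Proof.
by apply: eq_bigr => j _; rewrite !mxE; case: eqP; rewrite ?mulrNN.
Qed.

Lemma rvdot_ge0 (R : realType) (m : nat) (x : 'rV[R]_m) : 0 <= rvdot x x.
Proof. by apply: sumr_ge0 => j _; rewrite -expr2 sqr_ge0. Qed.

Lemma rvdot_eq0 (R : realType) (m : nat) (x : 'rV[R]_m) :
  (rvdot x x == 0) = (x == 0).
Proof.
apply/idP/eqP => [|->]; last by rewrite /rvdot big1 // => j _; rewrite mxE mul0r.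
rewrite psumr_eq0 => [/allP h|S _]; last by rewrite -expr2 sqr_ge0.
apply/rowP=> j; rewrite mxE; apply/eqP.
by rewrite -sqrf_eq0 expr2; apply: h; rewrite mem_index_enum.
Qed.

Lemma clvec_linear (R : realType) (m : nat) : linear (@clvec R m).
Proof.
move=> c x y; rewrite /clvec scaler_sumr -big_split; apply: eq_bigr => j _ /=.
by rewrite !mxE scalerDl scalerA.
Qed.

HB.instance Definition _ (R : realType) (m : nat) :=
  GRing.isLinear.Build R 'rV[R]_m (Cl R m) _ (@clvec R m)
    (@clvec_linear R m).

Lemma clvecE (R : realType) (m : nat) (x : 'rV[R]_m.+1) :
  clvec x = (x 0 0)%:A + \sum_(a < m) x 0 (lift ord0 a) *: clgen R (a : 'I_m.+1.-1).
Proof.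
rewrite /clvec big_ord_recl; congr (_ + _).
apply: eq_bigr => a _; congr (_ *: _); rewrite /clgen; congr ClE.
by apply/setP=> b; rewrite !inE /= /bump leq0n add1n eqSS.
Qed.

Lemma clrev_vec (R : realType) (m : nat) (x : 'rV[R]_m.+1) :
  clrev (clvec x) = clvec x.
Proof.
rewrite clvecE linearD linearZ /= clrev1 linear_sum /=; congr (_ + _).
by apply: eq_bigr => a _; rewrite linearZ /= clrev_gen.
Qed.

Lemma clbar_vec (R : realType) (m : nat) (x : 'rV[R]_m.+1) :
  clbar (clvec x) = clvec (rvbar x).
Proof.
rewrite !clvecE linearD linearZ /= clbar1 linear_sum /= !mxE /=; congr (_ + _).
apply: eq_bigr => a _; rewrite linearZ /= clbar_gen.
by rewrite mxE /= scalerN scaleNr.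
Qed.

Lemma clscaleM (R : realType) (m : nat) (s t : R) (x y : Cl R m) :
  (s *: x) * (t *: y) = (s * t) *: (x * y).
Proof. by rewrite -scalerAl -scalerAr scalerA. Qed.

Lemma clgen_mulD (R : realType) (m : nat) (a b : 'I_m.-1) :
  clgen R a * clgen R b + clgen R b * clgen R a = - (2 * (a == b)%:R)%:A.
Proof.
case: (eqVneq a b) => [->|nab]; last first.
  by rewrite clgen_anticomm // addNr mulr0 scale0r oppr0.
by rewrite clgen_sqr mulr1 scaler_nat mulr2n opprD.
Qed.

(** Write x = x_0 + X and y = y_0 + Y. Conjugation negates X and Y, so the mixed terms cancel, and
    anticommutation leaves only the diagonal terms of XY + YX. *)
Lemma clvec_polar (R : realType) (m : nat) (x y : 'rV[R]_m.+1) :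
  clvec x * clbar (clvec y) + clvec y * clbar (clvec x) = (2 * rvdot x y)%:A.
Proof.
rewrite !clbar_vec !clvecE.
set X := \sum_a _; set X' := \sum_a _; set Y := \sum_a _; set Y' := \sum_a _.
have -> : X' = - Y.
  by rewrite /X' /Y -sumrN; apply: eq_bigr => a _; rewrite mxE /= scaleNr.
have -> : Y' = - X.
  by rewrite /Y' /X -sumrN; apply: eq_bigr => a _; rewrite mxE /= scaleNr.
have XY : X * Y + Y * X = - (2 * \sum_(a < m) x 0 (lift ord0 a) * y 0 (lift ord0 a))%:A.
  rewrite /X /Y !mulr_suml.
  under eq_bigr do rewrite mulr_sumr.
  under [X in _ + X]eq_bigr do rewrite mulr_sumr.
  rewrite [X in _ + X]exchange_big -big_split /= mulr_sumr scaler_suml -sumrN.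
  have bil a b : (x 0 (lift ord0 a) *: clgen R a) * (y 0 (lift ord0 b) *: clgen R b) +
      (y 0 (lift ord0 b) *: clgen R b) * (x 0 (lift ord0 a) *: clgen R a) =
      - (2 * (a == b)%:R * (x 0 (lift ord0 a) * y 0 (lift ord0 b)))%:A :> Cl R m.+1.
    rewrite !clscaleM [y _ _ * x _ _]mulrC -scalerDr.
    by rewrite clgen_mulD scalerN scalerA mulrC.
  apply: eq_bigr => a _; rewrite -big_split (bigD1 a) //= big1 => [|b nab].
    by rewrite addr0 bil eqxx mulr1.
  by rewrite bil eq_sym (negbTE nab) mulr0 mul0r scale0r oppr0.
rewrite !mxE /= /rvdot big_ord_recl [2 * _]mulrDr [RHS]scalerDl.
rewrite -[X in _ = _ + X]opprK -XY mulr_natl mulr2n [in RHS]scalerDl.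
rewrite !mulrDl !mulrDr !mulrN !mulr_algl !mulr_algr !scalerA.
rewrite [y 0 0 * x 0 0]mulrC.
move: (X * Y) (Y * X) (y 0 0 *: X) (x 0 0 *: Y) ((_ * _)%:A) => A B C D s.
apply/ffunP=> T; rewrite !ffunE; ring.
Qed.

Lemma clvec_mul_bar (R : realType) (m : nat) (x : 'rV[R]_m.+1) :
  clvec x * clbar (clvec x) = (rvdot x x)%:A.
Proof.
have := clvec_polar x x; rewrite -mulr2n -scaler_nat -scalerA.
by apply: scalerI; rewrite pnatr_eq0.
Qed.

Lemma clnorm2_vec (R : realType) (m : nat) (x : 'rV[R]_m.+1) :
  clnorm2 (clvec x) = rvdot x x.
Proof.
rewrite -clmul_bar0 clvec_mul_bar -[1]ClE0 !ffunE eqxx /GRing.scale /=.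
by rewrite mulr1.
Qed.

Lemma clvec_bar_mul (R : realType) (m : nat) (x : 'rV[R]_m.+1) :
  clbar (clvec x) * clvec x = (rvdot x x)%:A.
Proof.
by rewrite -{2}[clvec x]clbarK clbar_vec clvec_mul_bar rvdot_bar.
Qed.

Lemma clvec_inj (R : realType) (m : nat) : injective (@clvec R m.+1).
Proof.
move=> x y /eqP; rewrite -subr_eq0 -linearB -clnorm2_eq0 clnorm2_vec rvdot_eq0.
by rewrite subr_eq0 => /eqP.
Qed.

Lemma clvec_invE (R : realType) (m : nat) (x : 'rV[R]_m.+1) : x != 0 ->
  clvec x \is a GRing.unit /\
  (clvec x)^-1 = clvec ((rvdot x x)^-1 *: rvbar x).
Proof.
move=> x0; have q0 : rvdot x x != 0 by rewrite rvdot_eq0.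
have e1 : clvec x * clvec ((rvdot x x)^-1 *: rvbar x) = 1.
  by rewrite linearZ /= -clbar_vec -scalerAr clvec_mul_bar scalerA mulVf ?scale1r.
have e2 : clvec ((rvdot x x)^-1 *: rvbar x) * clvec x = 1.
  by rewrite linearZ /= -clbar_vec -scalerAl clvec_bar_mul scalerA mulVf ?scale1r.
have u : clvec x \is a GRing.unit by apply/unitrP; eexists; split; eassumption.
by split=> //; apply: (mulrI u); rewrite mulrV.
Qed.

(** * The Clifford group: induction, units and multiplicativity of the norm *)

(** No case for inverses is left, because the inverse of a vector is a vector and (xy)^-1 = y^-1
    x^-1. The induction carries P for x and x^-1 together. *)
Lemma cliffGroup_vec_ind (R : realType) (m : nat) (P : Cl R m.+1 -> Prop) :
    (forall x : 'rV[R]_m.+1, x != 0 -> P (clvec x)) -> P 1 ->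
    (forall x y, cliffGroup x -> cliffGroup y -> P x -> P y -> P (x * y)) ->
  forall x, cliffGroup x -> P x.
Proof.
move=> Pv P1 PM x Gx.
suff [] : [/\ x \is a GRing.unit, P x & P x^-1] by [].
elim: Gx => {x} [v [x _ <-] v0||x y Gx [ux Px PVx] Gy [uy Py PVy]|x Gx [ux Px PVx]].
- have x0 : x != 0 by apply/eqP => x0; apply: v0; rewrite x0 linear0.
  have [u ve] := clvec_invE x0; split=> //; first exact: Pv.
  rewrite ve; apply: Pv; apply/eqP => e0.
  by move: u; rewrite -unitrV ve e0 linear0 unitr0.
- by rewrite unitr1 invr1.
- split; [by rewrite unitrMr | exact: PM |].
  by rewrite invrM //; apply: PM => //; exact: cliffGroup_inv.
- by rewrite unitrV invrK.
Qed.

Lemma cliffGroup_unit (R : realType) (m : nat) (x : Cl R m.+1) :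
  cliffGroup x -> x \is a GRing.unit.
Proof.
elim/cliffGroup_vec_ind: x / => [x /clvec_invE[]||x y _ _ ux uy] //.
  by rewrite unitr1.
by rewrite unitrMr.
Qed.

Lemma cliffGroup_neq0 (R : realType) (m : nat) (x : Cl R m.+1) :
  cliffGroup x -> x != 0.
Proof. by move=> /cliffGroup_unit; apply: contraTneq => ->; rewrite unitr0. Qed.

Lemma cliffGroup_clvec (R : realType) (m : nat) (x : 'rV[R]_m.+1) :
  x != 0 -> cliffGroup (clvec x).
Proof.
move=> x0; apply: cliffGroup_vec; first by exists x.
by move=> e; move: x0; rewrite -rvdot_eq0 -clnorm2_vec clnorm2_eq0 e eqxx.
Qed.

Lemma cliffGroup_rev (R : realType) (m : nat) (x : Cl R m.+1) :
  cliffGroup x -> cliffGroup (clrev x).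
Proof.
elim/cliffGroup_vec_ind: x / => [x x0||x y _ _ Gx Gy].
- by rewrite clrev_vec; exact: cliffGroup_clvec.
- by rewrite clrev1; exact: cliffGroup_one.
- by rewrite clrevM; exact: cliffGroup_mul.
Qed.

(** Induction shows that both products are real scalars. Their values are then read off from the
    coefficient at the empty set. *)
Lemma cliffGroup_mul_bar (R : realType) (m : nat) (x : Cl R m.+1) :
  cliffGroup x -> x * clbar x = (clnorm2 x)%:A /\ clbar x * x = (clnorm2 x)%:A.
Proof.
move=> Gx; suff [s [t [es et]]] : exists s t, x * clbar x = s%:A /\ clbar x * x = t%:A.
  have := clmul_bar0 x; have := clmul_0bar x; rewrite es et -[1]ClE0.
  by rewrite !ffunE eqxx /GRing.scale /= !mulr1 => -> ->.
elim/cliffGroup_vec_ind: x / Gx => [x x0||x y _ _ [s [t [es et]]] [s' [t' [es' et']]]].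
- by rewrite clvec_mul_bar clvec_bar_mul; do 2 eexists.
- by rewrite clbar1 mulr1; exists 1, 1; rewrite scale1r.
- exists (s * s'), (t' * t); rewrite clbarM; split.
    rewrite mulrA -[x * y * _]mulrA es' mulr_algr -scalerAl es.
    by rewrite scalerA mulrC.
  rewrite mulrA -[_ * clbar x * _]mulrA et mulr_algr -scalerAl et'.
  by rewrite scalerA mulrC.
Qed.

(** In bar(y) bar(x) x y the inner factor bar(x) x is a scalar and can be pulled out. *)
Lemma clnorm2Ml (R : realType) (m : nat) (x y : Cl R m.+1) :
  cliffGroup x -> clnorm2 (x * y) = clnorm2 x * clnorm2 y.
Proof.
move=> /cliffGroup_mul_bar[_ e]; rewrite -clmul_0bar clbarM mulrA.
rewrite -[_ * clbar x * _]mulrA e mulr_algr -scalerAl ffunE clmul_0bar.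
by rewrite /GRing.scale.
Qed.

Lemma clnorm2_gt0 (R : realType) (m : nat) (x : Cl R m.+1) :
  cliffGroup x -> 0 < clnorm2 x.
Proof.
by move=> /cliffGroup_neq0 x0; rewrite lt_neqAle clnorm2_ge0 eq_sym clnorm2_eq0 x0.
Qed.

Lemma clnorm2V (R : realType) (m : nat) (x : Cl R m.+1) :
  cliffGroup x -> clnorm2 x^-1 = (clnorm2 x)^-1.
Proof.
move=> Gx; have n0 : clnorm2 x != 0 by rewrite gt_eqF ?clnorm2_gt0.
apply: (mulfI n0); rewrite -clnorm2Ml // mulrV ?cliffGroup_unit //.
by rewrite clnorm2_1 divff.
Qed.

(** Multiply the polar identity u v + bar(v) bar(u) = 2 <u, bar(v)> on the right by u and use bar(u)
    u = |u|^2. *)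
Lemma clvec_sandwich (R : realType) (m : nat) (u v : 'rV[R]_m.+1) :
  clvec u * clvec v * clvec u =
  clvec ((2 * rvdot u (rvbar v)) *: u - rvdot u u *: rvbar v).
Proof.
have := clvec_polar u (rvbar v); rewrite clbar_vec rvbarK => /(congr1 ( *%R^~ (clvec u))).
rewrite mulrDl -[_ * clbar _ * _]mulrA clvec_bar_mul mulr_algl mulr_algr => e.
by rewrite linearB !linearZ /= -e scalerN addrK.
Qed.

(** * The inclusion of Clifford algebras *)

Lemma clemb_linear (R : realType) (n : nat) : linear (@clemb R n).
Proof.
move=> c x y; rewrite /clemb scaler_sumr -big_split; apply: eq_bigr => S _ /=.
by rewrite !ffunE scalerDl [in RHS]scalerA.
Qed.

HB.instance Definition _ (R : realType) (n : nat) :=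
  GRing.isLinear.Build R (Cl R n) (Cl R n.+1) _ (@clemb R n)
    (@clemb_linear R n).

Definition setemb (n : nat) (S : {set 'I_n.-1}) : {set 'I_n.+1.-1} :=
  (widen_ord (leq_pred n) @: S)%SET.

Lemma widen_inj (n m : nat) (le : (n <= m)%N) : injective (widen_ord le).
Proof. by move=> a b /(congr1 val) /= e; exact: val_inj. Qed.

Lemma setemb_inj (n : nat) : injective (@setemb n).
Proof. exact: imset_inj (@widen_inj _ _ _). Qed.

Lemma clemb_ClE (R : realType) (n : nat) (S : {set 'I_n.-1}) :
  clemb (ClE R S : Cl R n) = ClE R (setemb S).
Proof.
rewrite /clemb (bigD1 S) //= big1 => [|T nT].
  by rewrite ffunE eqxx scale1r addr0.
by rewrite ffunE (negbTE nT) scale0r.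
Qed.

Lemma clsign_emb (R : realType) (n : nat) (S T : {set 'I_n.-1}) :
  clsign R (setemb S) (setemb T) = clsign R S T.
Proof.
rewrite /clsign big_imset /=; last by move=> a b _ _; exact: widen_inj.
apply: eq_bigr => a _; rewrite big_imset //=.
by move=> b c _ _; exact: widen_inj.
Qed.

Lemma setemb_symdiff (n : nat) (S T : {set 'I_n.-1}) :
  setemb (symdiff S T) = symdiff (setemb S) (setemb T).
Proof.
apply/setP=> a; rewrite in_symdiff.
have [[b ->]|na] := pselect (exists b, a = widen_ord (leq_pred n) b).
  by rewrite !(mem_imset _ _ (@widen_inj _ _ _)) in_symdiff.
have ne U : (a \in setemb U) = false.
  by apply/negP => /imsetP[b _ e]; apply: na; exists b.
by rewrite !ne.
Qed.

(** By bilinearity it suffices to multiply basis elements, whose signs depend only on the order of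
    the generators, and [widen_ord] preserves that order. *)
Lemma clemb_is_monoid_morphism (R : realType) (n : nat) :
  monoid_morphism (@clemb R n).
Proof.
split=> [|x y].
  by rewrite -[1]ClE0 clemb_ClE /setemb imset0.
rewrite {1}[x]ClE_sum {1}[y]ClE_sum mulr_suml linear_sum.
rewrite [in RHS]/clemb mulr_suml; apply: eq_bigr => S _.
rewrite mulr_sumr linear_sum mulr_sumr; apply: eq_bigr => T _ /=.
rewrite !clscaleM !linearZ /= !ClEM linearZ /= clemb_ClE -!/(setemb _).
by rewrite clsign_emb setemb_symdiff.
Qed.

HB.instance Definition _ (R : realType) (n : nat) :=
  GRing.isMonoidMorphism.Build (Cl R n) (Cl R n.+1) (@clemb R n)
    (@clemb_is_monoid_morphism R n).

Lemma clemb_emb (R : realType) (n : nat) (x : Cl R n) (S : {set 'I_n.-1}) :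
  clemb x (setemb S) = x S.
Proof.
rewrite /clemb sum_ffunE (bigD1 S) //= big1 => [|T nT].
  by rewrite !ffunE eqxx /GRing.scale /= mulr1 addr0.
rewrite !ffunE (inj_eq (@setemb_inj n)) eq_sym (negbTE nT).
by rewrite /GRing.scale /= mulr0.
Qed.

Lemma clemb_out (R : realType) (n : nat) (x : Cl R n) (T : {set 'I_n.+1.-1}) :
  (forall S, T <> setemb S) -> clemb x T = 0.
Proof.
move=> nT; rewrite /clemb sum_ffunE big1 // => S _; rewrite !ffunE.
by case: eqP => [/nT//|_]; rewrite /GRing.scale /= mulr0.
Qed.

Lemma clemb_rev (R : realType) (n : nat) (x : Cl R n) :
  clrev (clemb x) = clemb (clrev x).
Proof.
apply/ffunP=> T; rewrite ffunE.
have [[S ->]|nT] := pselect (exists S, T = setemb S).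
  by rewrite !clemb_emb ffunE (card_imset _ (@widen_inj _ _ _)).
by rewrite !clemb_out ?mulr0 // => S e; apply: nT; exists S.
Qed.

Lemma clnorm2_emb (R : realType) (n : nat) (x : Cl R n) :
  clnorm2 (clemb x) = clnorm2 x.
Proof.
rewrite /clnorm2 (bigID (mem (@setemb n @: finset.setT)%SET)) /=.
rewrite [X in _ + X]big1 => [|T nT]; last first.
  rewrite clemb_out ?expr0n // => S e; move: nT; rewrite e.
  by rewrite imset_f ?inE.
rewrite addr0 big_imset /=; last by move=> S T _ _; exact: setemb_inj.
rewrite (eq_bigl xpredT) => [|S]; last by rewrite finset.in_setT.
by apply: eq_bigr => S _; rewrite clemb_emb.
Qed.

Lemma clemb_inj (R : realType) (n : nat) : injective (@clemb R n).
Proof.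
move=> x y e; apply/ffunP=> S.
by rewrite -[LHS]clemb_emb e clemb_emb.
Qed.

(** The inclusion of V_n in V_(n+1) as the boundary hyperplane: the default 0 of [oapp] is the new
    last coordinate. *)
Definition rvext (R : realType) (n : nat) (x : 'rV[R]_n) : 'rV[R]_n.+1 :=
  \row_j oapp (x 0) 0 (unlift ord_max j).

Lemma rvext_max (R : realType) (n : nat) (x : 'rV[R]_n) :
  rvext x 0 ord_max = 0.
Proof. by rewrite mxE unlift_none. Qed.

Lemma clemb_vec (R : realType) (n : nat) (x : 'rV[R]_n) :
  clemb (clvec x) = clvec (rvext x).
Proof.
rewrite /clvec linear_sum big_ord_recr /= rvext_max scale0r addr0.
apply: eq_bigr => j _; rewrite linearZ /= clemb_ClE mxE.
have -> : widen_ord (leqnSn n) j = lift ord_max j by apply: val_inj; rewrite [RHS]lift_max.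
rewrite liftK /=; congr (_ *: ClE _ _).
apply/setP=> a; rewrite inE; apply/imsetP/eqP => [[b]|aj].
  by rewrite inE => /eqP bj ->.
have lt : (a < n.-1)%N by rewrite ltn_predRL aj.
by exists (Ordinal lt); [rewrite inE /= aj | exact: val_inj].
Qed.

Lemma cliffGroup_emb (R : realType) (n : nat) (x : Cl R n.+1) :
  cliffGroup x -> cliffGroup (clemb x).
Proof.
elim/cliffGroup_vec_ind: x / => [x x0||x y _ _ Gx Gy].
- rewrite clemb_vec; apply: cliffGroup_clvec.
  by rewrite -rvdot_eq0 -clnorm2_vec -clemb_vec clnorm2_emb clnorm2_vec rvdot_eq0.
- by rewrite rmorph1; exact: cliffGroup_one.
- by rewrite rmorphM; exact: cliffGroup_mul.
Qed.

(* The map v |-> c v c^* of V_(n+1) is |c|^2 times an isometry fixing i_n. *)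
Lemma cliffGroup_sandwich (R : realType) (n : nat) (c : Cl R n.+1) :
    cliffGroup c -> forall v : 'rV[R]_n.+2,
  exists2 w, clemb c * clvec v * clrev (clemb c) = clvec w &
    w 0 ord_max = clnorm2 c * v 0 ord_max.
Proof.
elim/cliffGroup_vec_ind: c / => [x x0 v|v|x y Gx Gy Hx Hy v].
- rewrite clemb_vec clrev_vec clvec_sandwich; eexists; first by [].
  (* The last coordinate of [rvext x] is 0, so only the second term of [clvec_sandwich] remains, and
     [rvbar] negates the last coordinate of v. *)
  rewrite !mxE unlift_none /= mulr0 add0r mulrN opprK.
  by rewrite -!clnorm2_vec -clemb_vec clnorm2_emb.
- by exists v; rewrite ?rmorph1 ?clrev1 ?mul1r ?mulr1 ?clnorm2_1 ?mul1r.
- have [w ew wmax] := Hy v; have [z ez zmax] := Hx w; exists z.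
    by rewrite rmorphM clrevM -ez -ew !mulrA.
  by rewrite zmax wmax clnorm2Ml // mulrA.
Qed.

(** * Images of the sphere at infinity *)

Lemma clV_rev (R : realType) (n : nat) (x : Cl R n.+1) : clV x -> clrev x = x.
Proof. by move=> [u _ <-]; rewrite clrev_vec. Qed.

Lemma ord2P (i : 'I_2) : i = 0 \/ i = 1.
Proof. by case: i => [[|[|//]] ?]; [left|right]; exact: val_inj. Qed.

Lemma SL2_over_adj (R : realType) (n : nat) (O : set (Cl R n.+1))
    (g : 'M[Cl R n.+1]_2) :
    SL2_over O g ->
  clrev (g 0 0) * g 1 1 - clrev (g 1 0) * g 0 1 = 1.
Proof.
move=> [[_ det [/clV_rev abV /clV_rev cdV] _] _ [h [gh hg _]]].
pose adj : 'M[Cl R n.+1]_2 := \matrix_(i, j)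
  (if i == 0 then if j == 0 then clrev (g 1 1) else - clrev (g 0 1)
   else if j == 0 then - clrev (g 1 0) else clrev (g 0 0)).
have l1 : lift ord0 ord0 = 1 :> 'I_2 by exact: val_inj.
move: abV cdV; rewrite !clrevM !clrevK => ab cd.
have det' := congr1 (@clrev R n.+1) det.
move: det'; rewrite linearB /= !clrevM !clrevK clrev1 => det'.
have gadj : g *m adj = 1%:M.
  apply/matrixP=> i j; rewrite mxE !big_ord_recl big_ord0 addr0 l1 !mxE.
  case: (ord2P i) => ->; case: (ord2P j) => -> /=; rewrite ?mulrN.
  - exact: det.
  - by rewrite ab addNr.
  - by rewrite cd subrr.
  - by rewrite addrC.
have adjg : adj *m g = 1%:M.
  suff -> : adj = h by [].
  by rewrite -[adj]mul1mx -hg -mulmxA gadj mulmx1.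
have := congr1 (fun M : 'M[Cl R n.+1]_2 => M 1 1) adjg.
rewrite mxE !big_ord_recl big_ord0 addr0 l1 !mxE /= mulr1n => e.
by rewrite -[RHS]e mulNr addrC.
Qed.

Lemma moebiusN (R : realType) (n : nat) (g : 'M[Cl R n]_2) x y :
  moebius (- g) x y <-> moebius g x y.
Proof.
rewrite /moebius !mxE !linearN !mulNr -!opprD unitrN.
by split=> -[u]; rewrite invrN mulrNN.
Qed.

Lemma moebiusE (R : realType) (n : nat) (g : 'M[Cl R n]_2) x y :
  let den := clemb (g 1 0) * clvec x + clemb (g 1 1) in
  moebius g x y <-> den \is a GRing.unit /\
  clvec y * den = clemb (g 0 0) * clvec x + clemb (g 0 1).
Proof.
move=> den; rewrite /moebius -/den; split=> -[u e]; split=> //.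
  by rewrite e mulrVK.
by rewrite -e mulrK.
Qed.

Lemma PSL2_imageE (R : realType) (n : nat) (g : 'M[Cl R n]_2) A :
  PSL2_image [set g; - g] A = [set y | exists2 x, A x & moebius g x y].
Proof.
apply/seteqP; split=> y /=.
  by move=> [_ [->|->] [x Ax]]; [|move/moebiusN]; exists x.
by move=> h; exists g => //; left.
Qed.

Lemma rvdotZ (R : realType) (m : nat) (k : R) (x : 'rV[R]_m) :
  rvdot (k *: x) (k *: x) = k ^+ 2 * rvdot x x.
Proof. by rewrite /rvdot mulr_sumr; apply: eq_bigr => j _; rewrite !mxE; ring. Qed.

(** This solves t = -s^-1 in coordinates. It will relate s = y - p to t = c (x + w) c^* when y = g
    x. *)
Lemma clvec_mul_eqN1 (R : realType) (m : nat) (s t : 'rV[R]_m.+1) :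
  clvec s * clvec t = -1 <-> s != 0 /\ t = - ((rvdot s s)^-1 *: rvbar s).
Proof.
split=> [e|[s0 ->]]; last first.
  by have [u ie] := clvec_invE s0; rewrite linearN /= mulrN -ie mulrV.
have s0 : s != 0.
  apply/eqP => s0; move/eqP: e; rewrite s0 linear0 mul0r eq_sym oppr_eq0.
  by rewrite oner_eq0.
split=> //; have [u ie] := clvec_invE s0.
by apply: clvec_inj; apply: (mulrI u); rewrite e linearN /= mulrN -ie mulrV.
Qed.

(** If x_n = 1, then t = c (x + w) c^* has last coordinate |c|^2. But t = -(y - p)^-1 has last
    coordinate y_n / |y - p|^2, whence the equation for y. *)
Lemma image_sphere (R : realType) (n : nat) (g : 'M[Cl R n.+1]_2) :
    SL2 g -> clrev (g 0 0) * g 1 1 - clrev (g 1 0) * g 0 1 = 1 -> g 1 0 <> 0 ->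
  exists p : 'rV[R]_n.+2,
    [/\ p 0 ord_max = 0, clemb (g 0 0) = clvec p * clemb (g 1 0) &
      PSL2_image [set g; - g] (@sphere_infty R n.+1) =
      [set y : 'rV[R]_n.+2 | 0 < y 0 ord_max /\
         clnorm2 (g 1 0) * rvdot (y - p) (y - p) = y 0 ord_max]].
Proof.
move=> [Gg det [_ [v _ cdV]] [[u _ caV] _]] adj c0.
have Gc : cliffGroup (g 1 0) by case: (Gg 1 0).
move: (g 0 0) (g 0 1) (g 1 0) (g 1 1) (moebiusE g) cdV caV adj Gc {det c0 Gg}
  => a b c d gE cdV caV adj Gc.
have uc := cliffGroup_unit Gc.
have GV := cliffGroup_inv Gc.
have uC : clemb c \is a GRing.unit by rewrite rmorph_unit.
have uC' : clrev (clemb c) \is a GRing.unit by exact: clrev_unit.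
have eV : clemb c^-1 = (clemb c)^-1 by rewrite rmorphV.
(* Here u = c^* a and v = c d^* = d c^*, so p = c^-* u c^-1 = a c^-1 and w = c^-1 v c^-* = c^-1 d.
   Both have last coordinate 0, as [rvext u] and [rvext v] do. *)
have [p pE pmax] := cliffGroup_sandwich (cliffGroup_rev GV) (rvext u).
have [w wE wmax] := cliffGroup_sandwich GV (rvext v).
move: pE pmax; rewrite rvext_max mulr0 -clemb_rev clrevK eV clrev_inv //.
rewrite -clemb_vec caV rmorphM /= -clemb_rev mulKr // => pE pmax.
move: wE wmax; rewrite rvext_max mulr0 eV clrev_inv // -clemb_vec.
rewrite -(clrev_vec v) cdV clrevM clrevK rmorphM /= -clemb_rev mulrA mulrK // => wE wmax.
have aE : clemb a = clvec p * clemb c by rewrite -pE mulrVK.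
have dE : clemb d = clemb c * clvec w by rewrite -wE mulVKr.
(* Solve a^* d - c^* b = 1 for b, with a = p c and d = c w. *)
have bE : clemb b = clvec p * clemb c * clvec w - (clrev (clemb c))^-1.
  apply: (mulrI uC'); rewrite mulrBr mulrV // -(rmorph1 (@clemb R n.+1)) -adj.
  rewrite rmorphB !rmorphM /= -!clemb_rev opprB addrC aE clrevM clrev_vec dE.
  by rewrite !mulrA subrK.
exists p; split=> //.
rewrite PSL2_imageE; apply/seteqP; split=> y /=.
  move=> [x x1 /gE[uden]].
  have [t tE tmax] := cliffGroup_sandwich Gc (x + w).
  rewrite aE bE dE -!mulrA addrA -!mulrDr -linearD /= => e.
  have {}e : clvec (y - p) * clvec t = -1.
    rewrite -tE linearB /= mulrBl !mulrA -[X in X * _ - _]mulrA e mulrBl.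
    by rewrite !mulrA mulVr // addrAC subrr add0r.
  have [s0 tE'] := (clvec_mul_eqN1 _ _).1 e.
  move: tmax; rewrite tE' !mxE /= x1 wmax addr0 mulr1 pmax subr0 mulrN opprK => cE.
  have s_gt0 : 0 < rvdot (y - p) (y - p) by rewrite lt_neqAle rvdot_ge0 eq_sym rvdot_eq0 s0.
  have yE : clnorm2 c * rvdot (y - p) (y - p) = y 0 ord_max.
    by rewrite -cE mulrAC mulVf ?mul1r // gt_eqF.
  by split=> //; rewrite -yE mulr_gt0 // clnorm2_gt0.
move=> [y_gt0 yE].
have s0 : y - p != 0.
  apply: contraTneq y_gt0 => s0; rewrite -yE s0 /rvdot big1 ?mulr0 ?ltxx // => j _.
  by rewrite mxE mul0r.
have s_gt0 : 0 < rvdot (y - p) (y - p) by rewrite lt_neqAle rvdot_ge0 eq_sym rvdot_eq0 s0.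
(* This is the value that c (x + w) c^* must take; with z = c^-1 t c^-* the preimage of y is x = z -
   w. *)
pose t := - ((rvdot (y - p) (y - p))^-1 *: rvbar (y - p)).
have st : clvec (y - p) * clvec t = -1 by apply/clvec_mul_eqN1.
have tmax : t 0 ord_max = clnorm2 c.
  by rewrite !mxE /= pmax subr0 mulrN opprK -yE mulrCA mulVf ?mulr1 // gt_eqF.
have [z zE zmax] := cliffGroup_sandwich GV t.
exists (z - w).
  rewrite /sphere_infty /= !mxE wmax subr0 zmax tmax clnorm2V // mulVf //.
  by rewrite gt_eqF ?clnorm2_gt0.
have denE : clemb c * clvec (z - w) + clemb d = clvec t * (clrev (clemb c))^-1.
  rewrite dE -mulrDr -linearD /= subrK -zE eV clrev_inv //.
  by rewrite !mulrA mulrV // mul1r.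
apply/gE; rewrite denE; split.
  rewrite unitrMr ?unitrV //.
  suff t0 : t != 0 by have [] := clvec_invE t0.
  by apply: contraTneq y_gt0 => t0; move: tmax; rewrite t0 mxE -yE => <-; rewrite mul0r ltxx.
have yE' : clvec y = clvec (y - p) + clvec p by rewrite -linearD subrK.
rewrite yE' mulrDl mulrA st mulN1r bE aE -denE dE.
by rewrite mulrDr !mulrA addrC addrA.
Qed.

(** With c = 0 the condition a d^* = 1 gives d^-1 = a^*, so g x = a x a^* + b a^*. The translation b
    a^* = u lies in V_n and does not change heights. *)
Lemma image_plane (R : realType) (n : nat) (g : 'M[Cl R n.+1]_2) :
    SL2 g -> g 1 0 = 0 ->
  [/\ cliffGroup (g 0 0), cliffGroup (g 1 1), clnorm2 (g 0 0) * clnorm2 (g 1 1) = 1 &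
    PSL2_image [set g; - g] (@sphere_infty R n.+1) =
      [set y : 'rV[R]_n.+2 | y 0 ord_max = clnorm2 (g 0 0)]].
Proof.
move=> [Gg det [[u _ abV] _] _] c0.
have det1 : g 0 0 * clrev (g 1 1) = 1.
  by rewrite -det c0 linear0 mulr0 subr0.
have Ga : cliffGroup (g 0 0).
  case: (Gg 0 0) => // a0; move/eqP: det1; rewrite a0 mul0r eq_sym.
  by rewrite oner_eq0.
have Gd : cliffGroup (g 1 1).
  case: (Gg 1 1) => // a0; move/eqP: det1; rewrite a0 linear0 mulr0 eq_sym.
  by rewrite oner_eq0.
split=> //.
  by rewrite -(clnorm2_rev (g 1 1)) -clnorm2Ml // det1 clnorm2_1.
move: (g 0 0) (g 0 1) (g 1 0) (g 1 1) (moebiusE g) c0 abV det1 Ga Gd {det Gg}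
  => a b c d gE c0 abV det1 Ga Gd.
have GV := cliffGroup_inv Ga.
have ua := cliffGroup_unit Ga.
have uA : clemb a \is a GRing.unit by rewrite rmorph_unit.
have uA' : clrev (clemb a) \is a GRing.unit by exact: clrev_unit.
have eV : clemb a^-1 = (clemb a)^-1 by rewrite rmorphV.
have dE : clemb d = (clrev (clemb a))^-1.
  apply: (mulIr uA'); rewrite mulVr // clemb_rev -rmorphM -(clrevK d) -clrevM.
  by rewrite det1 clrev1 rmorph1.
have bE : clemb b = clvec (rvext u) * (clrev (clemb a))^-1.
  rewrite -clemb_vec -(clrev_vec u) abV clrevM clrevK rmorphM /= -clemb_rev.
  by rewrite mulrK.
rewrite PSL2_imageE; apply/seteqP; split=> y /=.
  move=> [x x1 /gE[_]]; rewrite c0 linear0 mul0r add0r dE bE => e.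
  have [t tE tmax] := cliffGroup_sandwich Ga x.
  have -> : y = t + rvext u.
    apply: clvec_inj; rewrite linearD /= -tE.
    have -> : clvec y = clvec y * (clrev (clemb a))^-1 * clrev (clemb a) by rewrite mulrVK.
    by rewrite e mulrDl mulrVK.
  by rewrite mxE tmax x1 rvext_max addr0 mulr1.
move=> ymax; have [t tE tmax] := cliffGroup_sandwich GV (y - rvext u).
exists t.
  rewrite /sphere_infty /= tmax !mxE unlift_none subr0 ymax clnorm2V // mulVf //.
  by rewrite gt_eqF ?clnorm2_gt0.
apply/gE; rewrite c0 linear0 mul0r add0r dE; split; first by rewrite unitrV.
rewrite -tE eV clrev_inv // !mulrA mulrV // mul1r bE linearB mulrBl.
by rewrite subrK.
Qed.

(** * Integrality of norms in an order *)

Lemma common_denominator (I : finType) (q : I -> rat) :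
  exists D : nat, (0 < D)%N /\ forall i, exists m : int, D%:R * q i = m%:~R.
Proof.
exists (\prod_i `|denq (q i)|)%N; split=> [|i].
  by rewrite prodn_gt0 // => i; rewrite absz_gt0 denq_neq0.
exists ((\prod_(j | j != i) `|denq (q j)|)%N%:Z * numq (q i)).
rewrite (bigD1 i) //= natrM rmorphM /= -pmulrn mulrAC mulrC; congr (_ * _).
rewrite pmulrn absz_denq -[X in _ * X]divq_num_den mulrCA divff ?mulr1 //.
by rewrite intr_eq0 denq_neq0.
Qed.

(** Let e be the reduced denominator of q. The exponent k = D suffices: e^D divides D, whereas e^D >
    D as soon as e is at least 2. *)
Lemma int_of_bounded_denominators (D : nat) (q : rat) : (0 < D)%N ->
    (forall k, exists m : int, D%:R * q ^+ k = m%:~R) ->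
  exists m : int, q = m%:~R.
Proof.
move=> D0 h; have [m em] := h D.
have d0 : (denq q)%:~R != 0 :> rat by rewrite intr_eq0 denq_neq0.
have e : D%:Z * numq q ^+ D = m * denq q ^+ D.
  apply: (@intr_inj rat); rewrite !rmorphM !rmorphXn /= -em.
  have -> : q ^+ D = (numq q)%:~R ^+ D / (denq q)%:~R ^+ D.
    by rewrite -expr_div_n divq_num_den.
  by rewrite -!mulrA mulVf ?mulr1 // expf_neq0.
have dv : (`|denq q| ^ D %| D)%N.
  rewrite -(@Gauss_dvdl _ _ (`|numq q| ^ D)%N); last first.
    by rewrite coprimeXl // coprimeXr // coprime_sym coprime_num_den.
  have := congr1 absz e; rewrite !abszM !abszX /= => ->.
  by rewrite dvdn_mull.
have d1 : denq q = 1.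
  have := dvdn_leq D0 dv; have := denq_gt0 q; case: (denq q) => // -[|[|k]] // _.
  by rewrite leqNgt ltn_expl.
by exists (numq q); rewrite -[LHS]divq_num_den d1 divr1.
Qed.

(** The coefficient of e_S in the increasing product of the generators sqrt(d_a) i_a of K for a in
    S. *)
Definition sqrtd (R : realType) (k : nat) (d : 'I_k -> nat) (S : {set 'I_k}) : R :=
  \prod_(a in S) Num.sqrt (d a)%:R.

Lemma sqrtdM (R : realType) (k : nat) (d : 'I_k -> nat) (S T : {set 'I_k}) :
  sqrtd R d S * sqrtd R d T =
  sqrtd R d (symdiff S T) * (\prod_(a in S :&: T) d a)%N%:R.
Proof.
rewrite natr_prod /sqrtd [X in X * _ = _]big_mkcond [X in _ * X = _]big_mkcond.
rewrite [X in _ = X * _]big_mkcond [X in _ = _ * X]big_mkcond -!big_split.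
apply: eq_bigr => a _ /=; rewrite in_symdiff inE; case: (a \in S); case: (a \in T) => /=; rewrite ?mulr1 ?mul1r //.
by rewrite -expr2 sqr_sqrtr.
Qed.

Lemma ratr1 (F : unitRingType) : ratr 1 = 1 :> F.
Proof. by rewrite (ratr_nat F 1). Qed.

(** The rational span of the elements sqrt(d_S) e_S contains the generators of K. It is closed under
    products, since by [sqrtdM] the product of two of the roots is an integer multiple of the root
    for the symmetric difference. *)
Lemma Kalg_coord (R : realType) (n : nat) (d : 'I_n.-1 -> nat) (x : Cl R n) :
  Kalg d x -> forall S, exists q : rat, x S = ratr q * sqrtd R d S.
Proof.
elim=> {x} [r|a|x y _ IHx _ IHy|x y _ IHx _ IHy] S.
- rewrite -[1]ClE0 !ffunE; case: eqP => [->|_]; last first.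
    by exists 0; rewrite /GRing.scale /= mulr0 rmorph0 mul0r.
  by exists r; rewrite /sqrtd big_set0.
- rewrite !ffunE; case: eqP => [->|_]; last first.
    by exists 0; rewrite /GRing.scale /= mulr0 rmorph0 mul0r.
  by exists 1; rewrite /sqrtd big_set1 ratr1 mul1r /GRing.scale /= mulr1.
- have [q eq] := IHx S; have [q' eq'] := IHy S; exists (q + q').
  by rewrite ffunE eq eq' rmorphD mulrDl.
rewrite ffunE.
elim/big_ind: _ => [|_ _ [q ->] [q' ->]|T _].
- by exists 0; rewrite rmorph0 mul0r.
- by exists (q + q'); rewrite rmorphD mulrDl.
have [q ->] := IHx T; have [q' ->] := IHy (symdiff T S).
rewrite mulrACA sqrtdM symdiffK.
have [s ->] : exists s : rat, clsign R T (symdiff T S) = ratr s.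
  rewrite /clsign; elim/big_ind: _ => [|_ _ [q1 ->] [q2 ->]|a _].
  - by exists 1; rewrite ratr1.
  - by exists (q1 * q2); rewrite rmorphM.
  elim/big_ind: _ => [|_ _ [q1 ->] [q2 ->]|b _].
  - by exists 1; rewrite ratr1.
  - by exists (q1 * q2); rewrite rmorphM.
  by exists ((-1) ^+ (b <= a)%N); rewrite rmorphXn rmorphN1.
exists (s * (q * q') * (\prod_(a in T :&: symdiff T S) d a)%N%:R).
by rewrite !rmorphM /= ratr_nat; ring.
Qed.

(** Let D clear the denominators of all coordinates of the finite basis relative to the roots
    [sqrtd]. Then D^2 |x|^2 is a sum of integer squares times products of the d_a. *)
Lemma lattice_denominator (R : realType) (n : nat) (d : 'I_n.-1 -> nat)
    (L : set (Cl R n)) :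
    full_lattice (Kalg d) L ->
  exists D : nat, (0 < D)%N /\
    forall x, L x -> exists m : int, D%:R * clnorm2 x = m%:~R.
Proof.
move=> [r [b [_ KE LE]]].
have Kb i : Kalg d (b i).
  rewrite KE; exists (fun j => (j == i)%:R) => //.
  rewrite (bigD1 i) //= big1 => [|j nj]; first by rewrite eqxx rmorph1 scale1r addr0.
  by rewrite (negbTE nj) rmorph0 scale0r.
have [q qE] := @choice ('I_r * {set 'I_n.-1}) rat
  (fun p q => b p.1 p.2 = ratr q * sqrtd R d p.2) (fun p => Kalg_coord (Kb p.1) p.2).
have [D [D0 /choice[m mE]]] := common_denominator q.
exists (D ^ 2)%N; split=> [|x]; first by rewrite expn_gt0 D0.
rewrite LE => -[z _ <-].
exists (\sum_S (\sum_i m (i, S) * z i) ^+ 2 * (\prod_(a in S :&: S) d a)%N%:Z).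
rewrite mulr_sumr rmorph_sum; apply: eq_bigr => S _.
rewrite natrX -exprMn.
have -> : D%:R * (\sum_i b i *~ z i : Cl R n) S =
    (\sum_i m (i, S) * z i)%:~R * sqrtd R d S.
  rewrite sum_ffunE mulr_sumr rmorph_sum mulr_suml; apply: eq_bigr => i _.
  have -> : (b i *~ z i) S = b i S * (z i)%:~R.
    by rewrite -scaler_int ffunE /GRing.scale /= mulrC.
  rewrite (qE (i, S)) /= rmorphM /= -[(m _)%:~R](ratr_int R) -mE rmorphM /= ratr_nat.
  by ring.
rewrite exprMn [in LHS](expr2 (sqrtd R d S)) sqrtdM.
have -> : symdiff S S = finset.set0 by apply/setP=> a; rewrite in_symdiff addbb inE.
by rewrite /sqrtd big_set0 mul1r rmorphM rmorphXn.
Qed.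

Lemma clnorm2X (R : realType) (m : nat) (x : Cl R m.+1) k :
  cliffGroup x -> clnorm2 (x ^+ k) = clnorm2 x ^+ k.
Proof.
move=> Gx; elim: k => [|k IH]; first by rewrite !expr0 clnorm2_1.
by rewrite !exprS clnorm2Ml // IH.
Qed.

(** Membership in the Clifford group is asked of [clemb x], because the elements to be tested arise
    as products involving points of V_(n+1). The embedding preserves powers and norms. *)
Lemma order_norm_int (R : realType) (n : nat) (d : 'I_n.-1 -> nat)
    (O : set (Cl R n)) (x : Cl R n) :
    is_order (Kalg d) O -> O x -> cliffGroup (clemb x) ->
  exists m : nat, clnorm2 x = m%:R.
Proof.
move=> [_ O1 _ OM /lattice_denominator[D [D0 DP]]] Ox Gx.
have Oxk k : O (x ^+ k) by elim: k => [|k IH]; rewrite ?expr0 ?exprS; [|exact: OM].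
have nX k : clnorm2 (x ^+ k) = clnorm2 x ^+ k.
  by rewrite -!(clnorm2_emb x) -clnorm2X // -rmorphXn clnorm2_emb.
have D0' : D%:R != 0 :> R by rewrite pnatr_eq0 -lt0n.
have [q qE] : exists q : rat, clnorm2 x = ratr q.
  have [m em] := DP _ Ox; exists (m%:~R / D%:R).
  by rewrite rmorphM /= fmorphV /= ratr_int ratr_nat -em mulrAC divff ?mul1r.
have [m mE] : exists m : int, q = m%:~R.
  apply: (int_of_bounded_denominators D0) => k.
  have [m em] := DP _ (Oxk k); exists m; apply: (fmorph_inj (@ratr R)).
  by rewrite rmorphM rmorphXn /= ratr_nat ratr_int -qE -nX.
exists `|m|%N; rewrite pmulrn gez0_abs; first by rewrite qE mE ratr_int.
by rewrite -(ler0z R) -(ratr_int R) -mE -qE clnorm2_ge0.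
Qed.

(** * Separation of Ford spheres *)

Lemma order_norm_ge1 (R : realType) (n : nat) (d : 'I_n.-1 -> nat)
    (O : set (Cl R n)) (x : Cl R n) :
  is_order (Kalg d) O -> O x -> cliffGroup (clemb x) -> 1 <= clnorm2 x.
Proof.
move=> HO Ox Gx; have [m mE] := order_norm_int HO Ox Gx.
move: (clnorm2_gt0 Gx); rewrite clnorm2_emb mE ltr0n => m0.
by rewrite ler1n.
Qed.

(** In terms of the radii r_i = 1 / (2 |c_i|^2), the bound reads |p_1 - p_2|^2 >= 4 r_1 r_2, which
    is the condition for the two balls not to overlap. *)
Lemma tangency_points_separated (R : realType) (n : nat) (d : 'I_n -> nat)
    (O : set (Cl R n.+1)) (g1 g2 : 'M[Cl R n.+1]_2) (p1 p2 : 'rV[R]_n.+2) :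
    is_order (Kalg (d : 'I_n.+1.-1 -> nat)) O -> (forall x, O x -> O (clrev x)) ->
    SL2_over O g1 -> SL2_over O g2 -> g1 1 0 <> 0 -> g2 1 0 <> 0 ->
    clemb (g1 0 0) = clvec p1 * clemb (g1 1 0) ->
    clemb (g2 0 0) = clvec p2 * clemb (g2 1 0) -> p1 <> p2 ->
  1 <= clnorm2 (g1 1 0) * clnorm2 (g2 1 0) * rvdot (p1 - p2) (p1 - p2).
Proof.
move=> HO Orev [[G1 _ _ _] O1 _] [[G2 _ _ _] O2 _] c1 c2 e1 e2 /eqP np.
have Gc1 : cliffGroup (g1 1 0) by case: (G1 1 0).
have Gc2 : cliffGroup (g2 1 0) by case: (G2 1 0).
have [_ _ OB OM _] := HO.
pose x := clrev (g1 0 0) * g2 1 0 - clrev (g1 1 0) * g2 0 0.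
have Ox : O x by apply: OB; apply: OM => //; exact: Orev.
have xE : clemb x = clrev (clemb (g1 1 0)) * (clvec (p1 - p2) * clemb (g2 1 0)).
  rewrite rmorphB !rmorphM /= -!clemb_rev e1 e2 clrevM clrev_vec.
  by rewrite linearB /= mulrBl mulrBr !mulrA.
have np' : p1 - p2 != 0 by rewrite subr_eq0.
have Gx : cliffGroup (clemb x).
  rewrite xE; apply: cliffGroup_mul; first exact/cliffGroup_rev/cliffGroup_emb.
  by apply: cliffGroup_mul; [exact: cliffGroup_clvec | exact: cliffGroup_emb].
have := order_norm_ge1 HO Ox Gx.
rewrite -clnorm2_emb xE clnorm2Ml; last exact/cliffGroup_rev/cliffGroup_emb.
rewrite clnorm2Ml; last exact: cliffGroup_clvec.
by rewrite clnorm2_rev !clnorm2_emb clnorm2_vec [rvdot _ _ * _]mulrC mulrA.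
Qed.

(** A common p gives a_1^* c_2 = c_1^* a_2. Multiplying d_1 a_1^* - c_1 b_1^* = 1 by c_2 then yields
    c_2 = c_1 u with u in O, and |u| >= 1. Exchanging g1 and g2 gives equality of norms. *)
Lemma same_tangency_norm_le (R : realType) (n : nat) (d : 'I_n -> nat)
    (O : set (Cl R n.+1)) (g1 g2 : 'M[Cl R n.+1]_2) (p : 'rV[R]_n.+2) :
    is_order (Kalg (d : 'I_n.+1.-1 -> nat)) O -> (forall x, O x -> O (clrev x)) ->
    SL2_over O g1 -> SL2_over O g2 -> g1 1 0 <> 0 -> g2 1 0 <> 0 ->
    clemb (g1 0 0) = clvec p * clemb (g1 1 0) ->
    clemb (g2 0 0) = clvec p * clemb (g2 1 0) ->
  clnorm2 (g1 1 0) <= clnorm2 (g2 1 0).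
Proof.
move=> HO Orev [[G1 det [_ /clV_rev cdV] _] O1 _] [[G2 _ _ _] O2 _] c1 c2 e1 e2.
have Gc1 : cliffGroup (g1 1 0) by case: (G1 1 0).
have Gc2 : cliffGroup (g2 1 0) by case: (G2 1 0).
have [_ _ OB OM _] := HO.
have ac : clrev (g1 0 0) * g2 1 0 = clrev (g1 1 0) * g2 0 0.
  apply: (@clemb_inj R n.+1); rewrite !rmorphM /= -!clemb_rev e1 e2 clrevM.
  by rewrite clrev_vec mulrA.
pose u := clrev (g1 1 1) * g2 0 0 - clrev (g1 0 1) * g2 1 0.
have Ou : O u by apply: OB; apply: OM => //; exact: Orev.
have cE : g2 1 0 = g1 1 0 * u.
  have := congr1 (@clrev R n.+1) det.
  rewrite linearB /= !clrevM !clrevK clrev1 => det'.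
  rewrite -[LHS]mul1r -det' mulrBl -mulrA ac mulrA.
  move: cdV; rewrite clrevM clrevK => ->.
  by rewrite mulrBr !mulrA.
have uE : u = (g1 1 0)^-1 * g2 1 0 by rewrite cE mulKr ?cliffGroup_unit.
have Gu : cliffGroup (clemb u).
  apply: cliffGroup_emb; rewrite uE; apply: cliffGroup_mul => //.
  exact: cliffGroup_inv.
rewrite cE clnorm2Ml // ler_peMr ?clnorm2_ge0 //.
exact: order_norm_ge1 HO Ou Gu.
Qed.

(** * Horospheres of the upper half-space *)

Lemma enormE (R : realType) (m : nat) (x : 'rV[R]_m) :
  enorm x = Num.sqrt (rvdot x x).
Proof. by congr Num.sqrt; apply: eq_bigr => j _; rewrite expr2. Qed.

Lemma enorm_eq (R : realType) (m : nat) (x : 'rV[R]_m) (r : R) : 0 < r ->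
  enorm x = r <-> rvdot x x = r ^+ 2.
Proof.
move=> r0; rewrite enormE; split=> [<-|->]; first by rewrite sqr_sqrtr ?rvdot_ge0.
by rewrite sqrtr_sqr gtr0_norm.
Qed.

Lemma enorm_le (R : realType) (m : nat) (x : 'rV[R]_m) (r : R) : 0 < r ->
  (enorm x <= r) = (rvdot x x <= r ^+ 2).
Proof.
move=> r0; rewrite enormE -[X in _ <= X](ger0_norm (ltW r0)) -sqrtr_sqr.
by rewrite ler_sqrt // exprn_ge0 // ltW.
Qed.

Lemma rvdotD_delta (R : realType) (m : nat) (x : 'rV[R]_m) (r : R) (j : 'I_m) :
  rvdot (x + r *: delta_mx 0 j) (x + r *: delta_mx 0 j) =
  rvdot x x + 2 * r * x 0 j + r ^+ 2.
Proof.
rewrite /rvdot (bigD1 j) //= [X in _ = X + _ + _](bigD1 j) //=.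
rewrite !mxE !eqxx /= mulr1.
under eq_bigr => i nij do rewrite !mxE /= (negbTE nij) mulr0 addr0.
by ring.
Qed.

Definition hsphere (R : realType) (n : nat) (c : 'rV[R]_n.+1) (r : R) :
  set 'rV[R]_n.+1 := [set x | Hyp x /\ enorm (x - c) = r].

Lemma hsphere_top (R : realType) (n : nat) (c : 'rV[R]_n.+1) (r : R) :
  0 < r -> c 0 ord_max = r -> hsphere c r (c + r *: delta_mx 0 ord_max).
Proof.
move=> r0 cr; split; first by rewrite /Hyp /= !mxE !eqxx cr mulr1 addr_gt0.
apply/enorm_eq => //; rewrite addrAC subrr rvdotD_delta mxE mulr0 addr0.
by rewrite /rvdot big1 ?add0r // => j _; rewrite mxE mul0r.
Qed.

(** The top point of each sphere lies on the other one. Half the sum of the two equations is |c -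
    c'|^2 + (r - r')^2 = 0. *)
Lemma hsphere_inj (R : realType) (n : nat) (c c' : 'rV[R]_n.+1) (r r' : R) :
    0 < r -> c 0 ord_max = r -> 0 < r' -> c' 0 ord_max = r' ->
  hsphere c r = hsphere c' r' -> c = c' /\ r = r'.
Proof.
move=> r0 cr r0' cr' e.
have := hsphere_top r0 cr; rewrite e => -[_ /(enorm_eq _ r0')].
have := hsphere_top r0' cr'; rewrite -e => -[_ /(enorm_eq _ r0)].
rewrite [c + _ - _]addrAC [c' + _ - _]addrAC !rvdotD_delta.
have -> : rvdot (c' - c) (c' - c) = rvdot (c - c') (c - c').
  by apply: eq_bigr => j _; rewrite !mxE; ring.
rewrite !mxE cr cr' => e1 e2.
have e3 : rvdot (c - c') (c - c') + (r - r') ^+ 2 = 0 by nra.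
have := rvdot_ge0 (c - c'); have := sqr_ge0 (r - r') => h1 h2.
have /eqP : rvdot (c - c') (c - c') = 0 by lra.
rewrite rvdot_eq0 subr_eq0 => /eqP cc; split=> //.
by rewrite -cr -cr' cc.
Qed.

Lemma hsphere_neq_plane (R : realType) (n : nat) (c : 'rV[R]_n.+2) (r h : R) :
    0 < r -> c 0 ord_max = r ->
  hsphere c r <> [set x : 'rV[R]_n.+2 | x 0 ord_max = h].
Proof.
move=> r0 cr e.
have top := hsphere_top r0 cr.
(* The top has height 2r and this point height r. In dimension [n.+2] the coordinate 0 is not the
   last one, so the displacement is horizontal. *)
have side : hsphere c r (c + r *: delta_mx 0 0).
  split; first by rewrite /Hyp /= !mxE /= mulr0 addr0 cr.
  apply/enorm_eq => //; rewrite addrAC subrr rvdotD_delta mxE mulr0 addr0.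
  by rewrite /rvdot big1 ?add0r // => j _; rewrite mxE mul0r.
move: top side; rewrite e /= !mxE !eqxx /= cr mulr1 mulr0 addr0 => <- h1.
by lra.
Qed.

Lemma plane_inj (R : realType) (n : nat) (h h' : R) :
  [set x : 'rV[R]_n.+1 | x 0 ord_max = h] = [set x | x 0 ord_max = h'] -> h = h'.
Proof.
move=> e; have : [set x : 'rV[R]_n.+1 | x 0 ord_max = h] (const_mx h).
  by rewrite /= mxE.
by rewrite e /= mxE.
Qed.

(** The one topological input: moving an interior point slightly in a chosen direction turns the
    weak inequality of a horoball into a strict one. *)
Lemma interior_ray (R : realType) (n : nat) (B : set 'rV[R]_n.+1)
    (z u : 'rV[R]_n.+1) :
  interior B z -> exists2 t : R, 0 < t & B (z + t *: u).
Proof.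
move=> /nbhs_ballP[e /= e0 eB].
have u1 : 0 < 1 + `|u| by rewrite ltr_pwDl.
(* The summand 1 keeps the denominator positive when u = 0 and makes the displacement strictly
   shorter than e. *)
exists (e / (1 + `|u|)); first by rewrite divr_gt0.
apply: eB; rewrite -ball_normE /= opprD addrA subrr add0r normrN normrZ.
rewrite ger0_norm; last by rewrite divr_ge0 // ltW.
rewrite mulrAC ltr_pdivrMr // ltr_pM2l //.
by rewrite ltrDr.
Qed.

Lemma interior_hball (R : realType) (n : nat) (c z : 'rV[R]_n.+1) (r : R) :
    0 < r -> interior [set x | Hyp x /\ enorm (x - c) <= r] z ->
  rvdot (z - c) (z - c) < r ^+ 2.
Proof.
move=> r0 /(interior_ray (z - c))[t t0 /= [_]]; rewrite enorm_le //.
have -> : z + t *: (z - c) - c = (1 + t) *: (z - c).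
  by rewrite scalerDl scale1r addrAC.
rewrite rvdotZ; have := rvdot_ge0 (z - c); set N := rvdot _ _ => N0 h.
have r2 : 0 < r ^+ 2 by rewrite exprn_gt0.
(* Pushing z radially outwards gains nothing at the centre, where the bound is 0 < r^2. *)
have [N1|N1] := ltP 0 N; last by lra.
by nra.
Qed.

Lemma interior_halfspace (R : realType) (n : nat) (z : 'rV[R]_n.+1) (h : R) :
  interior [set x : 'rV[R]_n.+1 | h <= x 0 ord_max] z -> h < z 0 ord_max.
Proof.
move=> /(interior_ray (- delta_mx 0 ord_max))[t t0 /=].
rewrite !mxE !eqxx /= mulrN mulr1 => le; lra.
Qed.

(** Let A, B, D be the squared distances from z to c1, from z to c2 and from c1 to c2. Then (r1 +
    r2) (r2 A + r1 B) - r1 r2 D is the sum of the squared coordinates of r2 (z - c1) + r1 (z - c2),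
    hence nonnegative. *)
Lemma open_balls_disjoint (R : realType) (m : nat) (c1 c2 z : 'rV[R]_m) (r1 r2 : R) :
    0 < r1 -> 0 < r2 -> (r1 + r2) ^+ 2 <= rvdot (c1 - c2) (c1 - c2) ->
    rvdot (z - c1) (z - c1) < r1 ^+ 2 ->
  rvdot (z - c2) (z - c2) < r2 ^+ 2 -> False.
Proof.
move=> r10 r20 le lt1 lt2.
have : r1 * r2 * rvdot (c1 - c2) (c1 - c2) <=
    (r1 + r2) * (r2 * rvdot (z - c1) (z - c1) + r1 * rvdot (z - c2) (z - c2)).
  rewrite /rvdot !mulr_sumr -big_split mulr_sumr /=; apply: ler_sum => j _.
  rewrite !mxE -subr_ge0; set a := z 0 j; set b := c1 0 j; set c := c2 0 j.
  have -> : (r1 + r2) * (r2 * ((a - b) * (a - b)) + r1 * ((a - c) * (a - c)))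
    - r1 * r2 * ((b - c) * (b - c)) = (r2 * (a - b) + r1 * (a - c)) ^+ 2 by ring.
  exact: sqr_ge0.
move: (rvdot (c1 - c2) _) (rvdot (z - c1) _) (rvdot (z - c2) _) le lt1 lt2
  => D A B le lt1 lt2 h.
have h1 : r2 * A < r2 * r1 ^+ 2 by rewrite ltr_pM2l.
have h2 : r1 * B < r1 * r2 ^+ 2 by rewrite ltr_pM2l.
have h3 : (r1 + r2) * (r2 * A + r1 * B) < (r1 + r2) * (r2 * r1 ^+ 2 + r1 * r2 ^+ 2).
  by rewrite ltr_pM2l ?addr_gt0 // ltrD.
have h4 : r1 * r2 * (r1 + r2) ^+ 2 <= r1 * r2 * D by rewrite ler_pM2l ?mulr_gt0.
have e : (r1 + r2) * (r2 * r1 ^+ 2 + r1 * r2 ^+ 2) = r1 * r2 * (r1 + r2) ^+ 2 by ring.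
by lra.
Qed.

Lemma rvdot_coord (R : realType) (m : nat) (x : 'rV[R]_m) (j : 'I_m) :
  x 0 j ^+ 2 <= rvdot x x.
Proof.
by rewrite /rvdot (bigD1 j) //= expr2 lerDl sumr_ge0 // => i _; rewrite -expr2 sqr_ge0.
Qed.

(** Complete the square: with r = 1 / (2k) and e_n the last unit vector, |y - p - r e_n|^2 = |y -
    p|^2 - 2 r y_n + r^2. *)
Lemma hsphereE (R : realType) (n : nat) (p : 'rV[R]_n.+1) (k : R) :
    0 < k -> p 0 ord_max = 0 ->
  [set y : 'rV[R]_n.+1 | 0 < y 0 ord_max /\ k * rvdot (y - p) (y - p) = y 0 ord_max] =
  hsphere (p + (2 * k)^-1 *: delta_mx 0 ord_max) (2 * k)^-1.
Proof.
move=> k0 p0; have r0 : 0 < (2 * k)^-1 by rewrite invr_gt0 mulr_gt0.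
apply/seteqP; split=> y /= [y0 e]; split=> //.
  apply/enorm_eq => //; rewrite opprD addrA -scaleNr rvdotD_delta !mxE p0 subr0.
  by rewrite -e sqrrN; field; rewrite gt_eqF.
move/(enorm_eq _ r0): e; rewrite opprD addrA -scaleNr rvdotD_delta !mxE p0 subr0.
set A := rvdot _ _; set r := (2 * k)^-1; rewrite sqrrN => e.
have -> : A = 2 * r * y 0 ord_max by lra.
by rewrite /r; field; rewrite gt_eqF.
Qed.

(** * Classification of the Ford spheres and the packing property *)

Lemma ford_spheres_cases (R : realType) (n : nat) (d : 'I_n -> nat)
    (O : set (Cl R n.+1)) (S : set 'rV[R]_n.+2) :
    is_order (Kalg (d : 'I_n.+1.-1 -> nat)) O -> ford_spheres O S ->
  S = [set y | y 0 ord_max = 1] \/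
  exists (g : 'M[Cl R n.+1]_2) (p : 'rV[R]_n.+2),
    [/\ SL2_over O g, g 1 0 <> 0 /\ (exists2 k : nat, (0 < k)%N & clnorm2 (g 1 0) = k%:R),
        p 0 ord_max = 0, clemb (g 0 0) = clvec p * clemb (g 1 0) &
        S = hsphere (p + (2 * clnorm2 (g 1 0))^-1 *: delta_mx 0 ord_max)
              (2 * clnorm2 (g 1 0))^-1].
Proof.
move=> HO [_ [g Og <-] <-]; have [Sg Oij _] := Og.
have [c0|c0] := pselect (g 1 0 = 0).
  left; have [Ga Gd ad ->] := image_plane Sg c0.
  (* |a|^2 and |d|^2 are natural numbers with product 1, so the height |a|^2 is 1. *)
  have [k ka] := order_norm_int HO (Oij 0 0) (cliffGroup_emb Ga).
  have [l ld] := order_norm_int HO (Oij 1 1) (cliffGroup_emb Gd).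
  move/eqP: ad; rewrite ka ld -natrM pnatr_eq1 muln_eq1 => /andP[/eqP -> _].
  by [].
right; have [p [p0 pE ->]] := image_sphere Sg (SL2_over_adj Og) c0.
have Gc : cliffGroup (g 1 0) by have [Gg _ _ _] := Sg; case: (Gg 1 0).
have [k kc] := order_norm_int HO (Oij 1 0) (cliffGroup_emb Gc).
exists g, p; split=> //; last by rewrite hsphereE // clnorm2_gt0.
by split=> //; exists k => //; move: (clnorm2_gt0 Gc); rewrite kc ltr0n.
Qed.

Theorem theorem1p1 (R : realType) (n : nat) (n_ge1 : (1 <= n)%N)
    (d : 'I_n.-1 -> nat)
    (d_gt0 : forall a, (0 < d a)%N)
    (d_sqfree : forall a, squarefree (d a))
    (q_posdef : forall y : 'rV[R]_n.-1, y != 0 -> 0 < diag_form d y)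
    (q_prim : primitive_diag d)
    (O : set (Cl R n))
    (O_order : is_order (Kalg d) O)
    (O_rev : forall x, O x -> O (clrev x)) :
  integral_packing (ford_spheres O).
Proof.
case: n n_ge1 d {d_gt0 d_sqfree q_posdef q_prim} O O_order O_rev => // n _ d O HO Orev.
have c_max (p : 'rV[R]_n.+2) r :
    p 0 ord_max = 0 -> (p + r *: delta_mx 0 ord_max) 0 ord_max = r.
  by move=> p0; rewrite !mxE !eqxx p0 mulr1 add0r.
have r_gt0 k : (0 < k)%N -> 0 < (2 * k%:R)^-1 :> R.
  by move=> k0; rewrite invr_gt0 mulr_gt0 // ltr0n.
(* [horoball] is a relation, so each Ford sphere must be shown to bound a single horoball, whichever
   constructor describes it. *)
have plane_ball (B : set 'rV[R]_n.+2) :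
    horoball [set y | y 0 ord_max = 1] B -> B = [set y | 1 <= y 0 ord_max].
  case=> [c r r0 cr /esym /(hsphere_neq_plane r0 cr)//|h _ /plane_inj <-].
  by [].
have sphere_ball (c : 'rV[R]_n.+2) r (B : set 'rV[R]_n.+2) :
    0 < r -> c 0 ord_max = r -> horoball (hsphere c r) B ->
    B = [set x | Hyp x /\ enorm (x - c) <= r].
  move=> r0 cr [c' r' r0' cr' /(hsphere_inj r0 cr r0' cr')[-> ->]//|h _].
  by move=> /(hsphere_neq_plane r0 cr).
split=> [S|S1 S2 B1 B2|S|S k].
- move=> /(ford_spheres_cases HO)[->|[g [p [_ [_ [k k0 ->]] p0 _ ->]]]].
    by eexists; exact: (horoball_hyperplane ltr01 erefl).
  by eexists; exact: (horoball_sphere (r_gt0 _ k0) (c_max _ _ p0) erefl).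
(* Distinct Ford spheres are not both the plane of height 1, and the claim is symmetric. *)
- wlog sph : S1 S2 B1 B2 / S1 <> [set y | y 0 ord_max = 1] => [wl F1 F2 S12 H1 H2|].
    have [e1|ne] := pselect (S1 = [set y | y 0 ord_max = 1]); last exact: (wl S1 S2).
    by rewrite setIC; apply: (wl S2 S1) => //; [rewrite -e1|]; exact: nesym.
  move=> /(ford_spheres_cases HO)[//|].
  move=> [g1 [p1 [Og1 [c1 [k1 k10 Q1]] p10 e1 ->]]] F2 S12.
  move: (r_gt0 _ k10) => r10; rewrite Q1 in S12 *.
  move=> /(sphere_ball _ _ _ r10 (c_max _ _ p10)) -> H2.
  rewrite -subset0 => z [] /= /(interior_hball r10) lt1.
  move: F2 S12 H2 => /(ford_spheres_cases HO)[->|].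
    move=> _ /plane_ball -> /interior_halfspace zmax.
    (* The last coordinate alone gives (z_n - r)^2 < r^2, so z_n < 2r = 1 / k1 <= 1, against z_n >
       1. *)
    have := le_lt_trans (rvdot_coord _ ord_max) lt1; rewrite mxE mxE c_max //.
    have r1le : 2 * (2 * k1%:R)^-1 <= 1 :> R.
      by rewrite invfM mulrA divff ?mul1r ?pnatr_eq0 // invf_le1 ?ltr0n // ler1n.
    move: r10 r1le zmax; move: (2 * _)^-1 (z _ _) => r h r0 r1 h1 /=.
    by rewrite lt_neqAle => /andP[_]; nra.
  move=> [g2 [p2 [Og2 [c2 [k2 k20 Q2]] p20 e2 ->]]] S12.
  move: (r_gt0 _ k20) => r20; rewrite Q2 in S12 *.
  move=> /(sphere_ball _ _ _ r20 (c_max _ _ p20)) -> /(interior_hball r20) lt2.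
  apply: open_balls_disjoint lt1 lt2 => //.
  have [p12|p12] := pselect (p1 = p2).
    (* With a common tangency point the norms agree, hence so do radii and centres, against S1 <>
       S2. *)
    rewrite -p12 in e2 S12; case: S12; suff -> : k1 = k2 by [].
    apply/eqP; rewrite -(eqr_nat R) -Q1 -Q2 eq_le.
    by rewrite (same_tangency_norm_le HO Orev Og1 Og2 c1 c2 e1 e2)
       (same_tangency_norm_le HO Orev Og2 Og1 c2 c1 e2 e1).
  have := tangency_points_separated HO Orev Og1 Og2 c1 c2 e1 e2 p12.
  rewrite Q1 Q2 => le.
  (* The squared distance of the centres is |p1 - p2|^2 + (r1 - r2)^2, and |p1 - p2|^2 >= 1 / (k1
     k2) = 4 r1 r2 makes it at least (r1 + r2)^2. *)
  rewrite opprD addrACA -scaleNr -scalerDl rvdotD_delta !mxE p10 p20 subr0 mulr0 addr0.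
  have k12 : 0 < k1%:R * k2%:R :> R by rewrite mulr_gt0 ?ltr0n.
  have : (k1%:R * k2%:R)^-1 <= rvdot (p1 - p2) (p1 - p2).
    by rewrite -div1r ler_pdivrMr // mulrC.
  have -> : (k1%:R * k2%:R)^-1 = 4 * (2 * k1%:R)^-1 * (2 * k2%:R)^-1 :> R.
    by field; rewrite !pnatr_eq0 -!lt0n k10 k20.
  by move: (_^-1) (_^-1) (rvdot _ _) => r r' D; nra.
- move=> /(ford_spheres_cases HO)[->|[g [p [_ [_ [k k0 ->]] p0 _ ->]]]].
    by eexists; exact: (curvature_hyperplane ltr01 erefl).
  by eexists; exact: (curvature_sphere (r_gt0 _ k0) (c_max _ _ p0) erefl).
(* Every admissible curvature must be treated. A hyperplane description gives 0; a sphere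
   description is impossible for the plane, and for a sphere it has r = 1 / (2l) by [hsphere_inj],
   hence curvature 2l. *)
- move=> /(ford_spheres_cases HO)[->|[g [p [_ [_ [l l0 ->]] p0 _ ->]]]].
    case=> [c r r0 cr /esym /(hsphere_neq_plane r0 cr)//|h _ _].
    by exists 0.
  case=> [c r r0 cr /(hsphere_inj (r_gt0 _ l0) (c_max _ _ p0) r0 cr)[_ <-]|h _ _].
    by exists (2 * l)%N; rewrite invrK -pmulrn natrM.
  by exists 0.
Qed.
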